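(* Suppose that $g\in W^{1,1}(\mathbb{R}^2)\cap W^{1,2}(\mathbb{R}^2)$ is bounded and monotone. Then $g$ is continuous, i.e. $g\in C(\mathbb{R}^2)$. In particular, if $f\in W^{1,2}(\mathbb{R}^2)$ is compactly supported and $\{f_i\}$ is a decomposition of $f$ into monotone components, then for all $i$ the monotone component $f_i$ is continuous.
   Context: Sobolev functions are always identified with their precise representatives: $f(x)=\lim_{r\to0}\frac{1}{|B(x,r)|}\int_{B(x,r)}f\,dy$ if this limit exists and is finite, and $f(x)=0$ otherwise. Monotonicity: the perimeter of a measurable set $E\subset\mathbb{R}^2$ is $P(E)=\sup\{\int_E\operatorname{div}\varphi\,dx:\varphi\in C_c^\infty(\mathbb{R}^2;\mathbb{R}^2),\ \|\varphi\|_\infty\le1\}$. A measurable set $E$ of finite perimeter is indecomposable if it cannot be written as a disjoint union $E=A\sqcup B$ of two measurable sets of positive measure with $P(E)=P(A)+P(B)$. A function $g\in W^{1,1}(\mathbb{R}^2)$ is monotone if the sets $\{g>t\}$ and $\{g<t\}$ are indecomposable for a.e. $t\in\mathbb{R}$. Decomposition of $f$ into monotone components: an at most countable family of compactly supported monotone functions $f_i\in W^{1,2}(\mathbb{R}^2)$ such that for each $i$ either $0\le f_i\le1$ a.e. or $-1\le f_i\le0$ a.e., and (a) $f=\sum_i f_i$ with convergence in $L^1_{\mathrm{loc}}(\mathbb{R}^2)$; (b) $|Df|=\sum_i|Df_i|$ as measures (here $Df=\nabla f\,\mathscr{L}^2$ and $|\cdot|$ is total variation); (c) the sets $\{\nabla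 f_i\ne0\}$ are pairwise disjoint up to Lebesgue negligible sets. *)

(* Defs.v *)
From mathcomp Require Import all_boot all_order all_algebra.
From mathcomp Require Import all_classical all_reals all_analysis.

Set Implicit Arguments.
Unset Strict Implicit.
Unset Printing Implicit Defensive.

Import Order.TTheory GRing.Theory Num.Theory.
Import numFieldNormedType.Exports.

Local Open Scope classical_set_scope.
Local Open Scope ring_scope.

(* The measurable sets of R * R are the Borel sets. Sobolev functions are
   represented by Borel functions, determined up to a.e. equality: every class
   of Lebesgue measurable functions contains a Borel one. Likewise [perimeter]
   and [indecomposable] are unaffected by negligible modifications, so Borel
   sets may stand for Lebesgue measurable ones. *)
Definition lebesgue2 (R : realType) :
    {measure set (measurableTypeR R * measurableTypeR R) -> \bar R} :=
  ((@lebesgue_measure R) \x (@lebesgue_measure R))%E.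

(* The library's norm on R * R is the sup norm: Euclidean norm and balls are
   spelled out. *)
Definition euclid (R : realType) (v : R * R) : R :=
  Num.sqrt (v.1 ^+ 2 + v.2 ^+ 2).

Definition disc (R : realType) (x : R * R) (r : R) : set (R * R) :=
  [set y | euclid (y - x) < r].

Definition average (R : realType) (f : R * R -> R) (x : R * R) (r : R) : R :=
  (fine (lebesgue2 R (disc x r)))^-1
  * \int[lebesgue2 R]_(y in disc x r) f y.

Definition precise (R : realType) (f : R * R -> R) (x : R * R) : R :=
  if `[< cvg (average f x r @[r --> 0^'+]) >]
  then lim (average f x r @[r --> 0^'+]) else 0.

Definition partial (R : realType) (j : bool) (f : R * R -> R) (x : R * R) : R :=
  'D_(if j then (0, 1) else (1, 0)) f x.

(* C^infty: all iterated partial derivatives (indexed by words in the two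
   coordinate directions) exist and are continuous. *)
Definition smooth (R : realType) (f : R * R -> R) : Prop :=
  forall s : seq bool, let h := foldr (@partial R) f s in
    continuous h /\
    forall x, derivable h x (1, 0) /\ derivable h x (0, 1).

Definition test_function (R : realType) (f : R * R -> R) : Prop :=
  smooth f /\ compact (closure [set x | f x != 0]).

Definition locally_integrable (R : realType) (f : R * R -> R) : Prop :=
  measurable_fun setT f /\
  forall K : set (R * R), compact K -> (lebesgue2 R).-integrable K (EFin \o f).

Definition is_weak_partial (R : realType) (j : bool) (f w : R * R -> R) : Prop :=
  forall phi, test_function phi ->
    \int[lebesgue2 R]_x (f x * partial j phi x)
    = - \int[lebesgue2 R]_x (w x * phi x).

Definition is_weak_gradient (R : realType) (f : R * R -> R)
    (u : R * R -> R * R) : Prop :=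
  [/\ locally_integrable f,
      locally_integrable (fst \o u), locally_integrable (snd \o u),
      is_weak_partial false f (fst \o u) & is_weak_partial true f (snd \o u)].

(* Weak gradients are unique up to a.e. equality; [grad f] picks one, and is 0
   if f has none. *)
Definition grad (R : realType) (f : R * R -> R) : R * R -> R * R :=
  xget (cst 0) (is_weak_gradient f).

(* W^{1,p}(R^2) *)
Definition sobolev (R : realType) (p : \bar R) (f : R * R -> R) : Prop :=
  f \in Lfun (lebesgue2 R) p /\
  exists u, [/\ is_weak_gradient f u,
    fst \o u \in Lfun (lebesgue2 R) p & snd \o u \in Lfun (lebesgue2 R) p].

Definition ess_bounded (R : realType) (f : R * R -> R) : Prop :=
  exists M : R, {ae lebesgue2 R, forall x, `|f x| <= M}.

Definition compactly_supported (R : realType) (f : R * R -> R) : Prop :=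
  exists2 K : set (R * R), compact K &
    {ae lebesgue2 R, forall x, ~ K x -> f x = 0}.

Definition divergence (R : realType) (phi : R * R -> R * R) (x : R * R) : R :=
  partial false (fst \o phi) x + partial true (snd \o phi) x.

Definition perimeter (R : realType) (E : set (R * R)) : \bar R :=
  ereal_sup [set (\int[lebesgue2 R]_(x in E) divergence phi x)%:E |
    phi in [set phi : R * R -> R * R |
      [/\ test_function (fst \o phi), test_function (snd \o phi) &
          forall x, euclid (phi x) <= 1]]].

Definition indecomposable (R : realType) (E : set (R * R)) : Prop :=
  [/\ measurable E, (perimeter E < +oo)%E &
    ~ exists A B : set (R * R),
      [/\ measurable A /\ measurable B, A `|` B = E, A `&` B = set0,
          (0 < lebesgue2 R A)%E /\ (0 < lebesgue2 R B)%E &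
          perimeter E = (perimeter A + perimeter B)%E]].

Definition monotone_fun (R : realType) (g : R * R -> R) : Prop :=
  sobolev 1%E g /\
  {ae @lebesgue_measure R, forall t : R,
    indecomposable [set x | t < g x] /\ indecomposable [set x | g x < t]}.

(* The R^2-valued measure Df = (grad f) L^2. *)
Definition Dmeas (R : realType) (f : R * R -> R) (B : set (R * R)) : R * R :=
  (\int[lebesgue2 R]_(x in B) (grad f x).1,
   \int[lebesgue2 R]_(x in B) (grad f x).2).

Definition variation_measure (R : realType) (nu : set (R * R) -> R * R)
    (B : set (R * R)) : \bar R :=
  ereal_sup [set (\sum_(0 <= n <oo) (euclid (nu (E n)))%:E)%E |
    E in [set E : nat -> set (R * R) |
      [/\ forall n, measurable (E n), trivIset setT E & \bigcup_n E n = B]]].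

(* The at most countable family is indexed by a set D of naturals; the values
   f_ i for i outside D are irrelevant. *)
Definition monotone_decomposition (R : realType) (f : R * R -> R)
    (D : set nat) (f_ : nat -> R * R -> R) : Prop :=
  [/\ forall i, D i ->
        [/\ sobolev 2%:E (f_ i), compactly_supported (f_ i), monotone_fun (f_ i) &
            {ae lebesgue2 R, forall x, 0 <= f_ i x <= 1} \/
            {ae lebesgue2 R, forall x, -1 <= f_ i x <= 0}],
      forall K : set (R * R), compact K ->
        (\int[lebesgue2 R]_(x in K)
           `|f x - \sum_(i < n | `[< D i >]) f_ i x|%:E)%E
          @[n --> \oo] --> 0%E,
      forall B : set (R * R), measurable B ->
        variation_measure (Dmeas f) B
        = (\esum_(i in D) variation_measure (Dmeas (f_ i)) B)%E &
      forall i j, D i -> D j -> i <> j ->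
        (lebesgue2 R).-negligible
          ([set x | grad (f_ i) x != 0] `&` [set x | grad (f_ j) x != 0])].

(* Main.v *)
(* Fix a point x0 and a small r. Since |grad g|^2 is integrable, the integral of
   |grad g| over the square of half-side 3r around x0 is o(r), so there are four
   lines, at distances between r and 2r from x0, bounding a rectangle Q on whose
   boundary g deviates from some constant c by at most a small e. If t > c + e,
   then {g > t} has zero density along the boundary of Q, so its perimeter is the sum of
   the perimeters of {g > t} /\ Q and {g > t} \ Q: competitors for the two pieces
   can be glued by a cutoff. By indecomposability one of the pieces is
   negligible; for r small it is the one inside Q, as a set of positive measure is
   not contained in arbitrarily small squares. As g is bounded, finitely many
   levels t suffice, so r can be chosen uniformly, and the same holds for {g < t}
   with t < c - e. Hence the essential oscillation of g around x0 tends to 0, and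
   averages over discs converge to a continuous function. *)

Require Import Defs.
From mathcomp Require Import all_boot all_order all_algebra.
From mathcomp Require Import all_classical all_reals all_analysis.
From mathcomp Require Import measurable_realfun ring lra.
Import Order.TTheory GRing.Theory Num.Theory.
Import numFieldNormedType.Exports.
Local Open Scope classical_set_scope.
Local Open Scope ring_scope.

Set Implicit Arguments.
Unset Strict Implicit.
Unset Printing Implicit Defensive.

(** * Smooth functions *)

(** The condition on the boundary of Q is expressed by measure alone, without traces: the part of E
    within distance h of the boundary has measure o(h). Gluing two fields there costs a gradient of
    size K/h on that part, hence o(1). Such boundaries exist because, at a Lebesgue point a of the
    slice measure, a null slice over a forces the strip of half-width h around it to meet E in
    measure o(h). The oscillation of g along lines comes from its weak gradient tested on products
    of one-variable functions. On almost every line, countably many differences of smooth steps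
    suffice to compare values at Lebesgue points, so no absolutely continuous representative is
    chosen. The bound o(r) is Cauchy-Schwarz: the square has area of order r^2 and the integral of
    |grad g|^2 over it tends to 0. The order of choices shapes the statements: c is known only after
    Q, and Q only after r, whereas r must suit every level used. So the levels are fixed on a grid
    in advance, and the almost everywhere statements about lines hold for all levels at once, with
    nullity of the slice as a hypothesis inside them. *)

Section smooth_functions_of_one_variable.
Context {R : realType}.
Implicit Types f g : R -> R.

Definition smooth1 f : Prop := forall n (x : R), derivable (derive1n n f) x 1.

(** Coinduction: smoothness is proved by exhibiting a class stable under differentiation, so no
    formula for an n-th derivative is needed. *)
Lemma smooth1_coind (P : (R -> R) -> Prop) :
  (forall f, P f -> (forall x : R, derivable f x 1) /\ P (derive1 f)) ->
  forall f, P f -> smooth1 f.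
Proof.
move=> HP f Pf n; elim: n f Pf => [|n IH] f Pf x.
  exact: (HP _ Pf).1.
by rewrite derive1Sn; apply: IH; exact: (HP _ Pf).2.
Qed.

Lemma smooth1_derive1 f : smooth1 f -> smooth1 (derive1 f).
Proof. by move=> sf n x; rewrite -derive1Sn; exact: sf. Qed.

Lemma smooth1_derivable f : smooth1 f -> forall x : R, derivable f x 1.
Proof. by move=> sf x; exact: (sf 0). Qed.

Lemma derivable_continuous f : (forall x : R, derivable f x 1) -> continuous f.
Proof. by move=> df x; exact/differentiable_continuous/derivable1_diffP/df. Qed.

Lemma smooth1_continuous f : smooth1 f -> continuous f.
Proof. by move=> sf; exact/derivable_continuous/smooth1_derivable. Qed.

Lemma smooth1_cst (c : R) : smooth1 (cst c).
Proof.
apply: (@smooth1_coind (fun f => exists c, f = cst c)); last by exists c.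
move=> _ [{}c ->]; split=> [x|]; first exact: derivable_cst.
by exists 0; apply/funext => x; rewrite derive1_cst.
Qed.

(** The product and quotient rules produce sums of products, so the invariant class is the whole
    algebra generated by smooth functions and inverses. *)
Inductive smooth1_alg : (R -> R) -> Prop :=
| smooth1_alg_base f : smooth1 f -> smooth1_alg f
| smooth1_algD f g : smooth1_alg f -> smooth1_alg g -> smooth1_alg (f \+ g)
| smooth1_algM f g : smooth1_alg f -> smooth1_alg g -> smooth1_alg (f \* g)
| smooth1_algV f : (forall x, f x != 0) -> smooth1_alg f ->
    smooth1_alg (fun x => (f x)^-1).

Lemma smooth1_alg_smooth1 f : smooth1_alg f -> smooth1 f.
Proof.
apply: smooth1_coind; move=> {}f; elim=> {f} [f sf|f g _ [df Pf] _ [dg Pg]| |].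
- by split; [exact: smooth1_derivable|exact/smooth1_alg_base/smooth1_derive1].
- split=> [x|]; first exact: derivableD.
  suff -> : derive1 (f \+ g) = (derive1 f) \+ (derive1 g) by exact: smooth1_algD.
  by apply/funext => x /=; rewrite !derive1E deriveD.
- move=> f g Af [df Pf] Ag [dg Pg].
  split=> [x|]; first exact: derivableM.
  suff -> : derive1 (f \* g) = (f \* (derive1 g)) \+ (g \* (derive1 f)).
    by apply: smooth1_algD; exact: smooth1_algM.
  by apply/funext => x /=; rewrite !derive1E deriveM.
- move=> f f0 Af [df Pf].
  have D (x : R) : is_derive x 1 (fun x => (f x)^-1) (- (f x) ^- 2 *: derive1 f x).
    by rewrite derive1E; apply: is_deriveV => //; exact/derivableP.
  split=> [x|]; first by have [] := D x.
  suff -> : derive1 (fun x => (f x)^-1) =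
      (cst (-1) \* derive1 f) \* ((fun x => (f x)^-1) \* (fun x => (f x)^-1)).
    apply: smooth1_algM; apply: smooth1_algM => //; [|exact: smooth1_algV..].
    exact/smooth1_alg_base/smooth1_cst.
  apply/funext => x; rewrite derive1E; have [_ ->] := D x.
  by rewrite /GRing.scale/= expr2 invfM; ring.
Qed.

Lemma smooth1V f : smooth1 f -> (forall x, f x != 0) -> smooth1 (fun x => (f x)^-1).
Proof.
by move=> sf f0; apply/smooth1_alg_smooth1/smooth1_algV => //; exact: smooth1_alg_base.
Qed.


Lemma smooth1M f g : smooth1 f -> smooth1 g -> smooth1 (f \* g).
Proof.
by move=> sf sg; apply/smooth1_alg_smooth1/smooth1_algM; exact: smooth1_alg_base.
Qed.

Lemma smooth1D f g : smooth1 f -> smooth1 g -> smooth1 (f \+ g).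
Proof.
by move=> sf sg; apply/smooth1_alg_smooth1/smooth1_algD; exact: smooth1_alg_base.
Qed.

Lemma is_derive_affine f (k b x : R) :
  derivable f (k * x + b) 1 ->
  is_derive x 1 (fun x => f (k * x + b)) (k * (derive1 f) (k * x + b)).
Proof.
move=> df.
have Df : is_derive (k * x + b) 1 f ((derive1 f) (k * x + b)).
  by rewrite derive1E; exact/derivableP.
have Dg : is_derive x 1 (fun x => k * x + b) k.
  apply: is_derive_eq; by rewrite addr0 /GRing.scale /= mulr1.
have := is_derive1_comp (f := f) (g := fun x => k * x + b) (x := x).
move=> /(_ _ _ Df Dg); rewrite mulrC; exact.
Qed.

Lemma derive1_affine f (k b x : R) : derivable f (k * x + b) 1 ->
  derive1 (fun x => f (k * x + b)) x = k * (derive1 f) (k * x + b).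
Proof. by move=> df; rewrite derive1E; have [_ ->] := is_derive_affine df. Qed.

Lemma smooth1_affine f (k b : R) : smooth1 f -> smooth1 (fun x => f (k * x + b)).
Proof.
(* The scalar [c] absorbs the factor [k] that each differentiation produces. *)
move=> sf; apply: (@smooth1_coind (fun h => exists f c,
    smooth1 f /\ h = fun x => c * f (k * x + b))); last first.
  by exists f, 1; split => //; apply/funext => x; rewrite mul1r.
move=> _ [{sf}f [c [sf ->]]].
have D (x : R) : is_derive x 1 (fun x => c * f (k * x + b)) (c * (k * (derive1 f) (k * x + b))).
  by have := is_derive_affine (sf 0 (k * x + b)) => ?; exact: is_deriveZ.
split=> [x|]; first by have [] := D x.
exists (derive1 f), (c * k); split; first exact: smooth1_derive1.
by apply/funext => x; rewrite derive1E; have [_ ->] := D x; rewrite mulrA.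
Qed.

Lemma smooth1N f : smooth1 f -> smooth1 (\- f).
Proof.
move=> sf; have := smooth1M (@smooth1_cst (-1)) sf.
by congr smooth1; apply/funext => x /=; rewrite mulN1r.
Qed.

Lemma smooth1B f g : smooth1 f -> smooth1 g -> smooth1 (f \- g).
Proof. by move=> sf sg; exact: (smooth1D sf (smooth1N sg)). Qed.

(* The derivative of [x^-n e^(-1/x)] is [x^-(n+2) e^(-1/x) - n x^-(n+1) e^(-1/x)],
   so the span of these functions is closed under differentiation. *)
Definition flat (n : nat) (x : R) : R :=
  if 0 < x then x ^- n * expR (- x^-1) else 0.

(** A single term of the exponential series gives e^(1/x) >= x^-(n+1) / (n+1)!. *)
Lemma flat_le n (x : R) : 0 < x -> flat n x <= (n.+1)`!%:R * x.
Proof.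
move=> x0; rewrite /flat x0.
have := expR_ge1Dxn n (ltW (_ : 0 < x^-1)); rewrite invr_gt0 => /(_ x0) h.
have : x^-1 ^+ n.+1 / n.+1`!%:R <= expR x^-1 by apply: le_trans h; rewrite lerDr.
rewrite expRN ler_pdivrMr ?ltr0n ?fact_gt0// => {}h.
rewrite ler_pdivrMr ?expR_gt0//.
rewrite exprVn in h.
have -> : x ^- n = x * x ^- n.+1.
  by rewrite exprS invfM mulrA divff ?gt_eqF// mul1r.
by rewrite [_ * x]mulrC -mulrA ler_pM2l// mulrC.
Qed.

Lemma flat_ge0 n x : 0 <= flat n x.
Proof.
rewrite /flat; case: ifPn => // x0.
by rewrite mulr_ge0 ?expR_ge0// invr_ge0 exprn_ge0// ltW.
Qed.

Lemma is_derive_flat n (x : R) :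
  is_derive x 1 (flat n) (flat n.+2 x - n%:R * flat n.+1 x).
Proof.
have [x0|x0|->] := ltgtP x 0.
- rewrite /flat !ltNge (ltW x0)/= mulr0 subr0.
  apply: (@near_eq_is_derive R R R (cst 0)).
  + near=> y; rewrite /flat ltNge (@ltW _ _ y 0)//=.
    by near: y; exact: lt_nbhsl.
- apply: (@near_eq_is_derive R R R (fun x : R => x ^- n * expR (- x^-1))).
  + near=> y; rewrite /flat (_ : 0 < y)//.
    near: y; exact: lt_nbhsr.
  have xn0 : x != 0 by rewrite gt_eqF.
  have D1 : is_derive x 1 (fun x : R => x^-1) (- x ^- 2).
    apply: is_derive_eq; first exact: is_deriveV.
    by rewrite /GRing.scale/= mulr1.
  have D2 : is_derive x 1 (fun x : R => expR (- x^-1)) (x ^- 2 * expR (- x^-1)).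
    have D0 : is_derive x 1 (fun x : R => - x^-1) (x ^- 2).
      by rewrite -[x ^- 2]opprK; exact: is_deriveN.
    have D4 : is_derive (- x^-1) 1 expR (expR (- x^-1)) by exact: is_derive_expR.
    by rewrite mulrC; exact: (@is_derive1_comp R expR (fun x : R => - x^-1) x _ _ D4 D0).
  have xnn0 : x ^+ n != 0 by rewrite expf_neq0.
  have D3 : is_derive x 1 (fun x : R => x ^- n) (- n%:R * x ^- n.+1).
    have DX : is_derive x 1 (fun x : R => x ^+ n) (n%:R * x ^+ n.-1).
      apply: DeriveDef; first exact: exprn_derivable.
      by rewrite exp_derive /GRing.scale/= mulr1.
    have DV := @is_deriveV R (fun x : R => x ^+ n) x _ 1 xnn0 DX.
    apply: (is_derive_eq DV).
    rewrite /GRing.scale/=; case: (n) => [|m]; first by rewrite !mul0r mulr0 oppr0 mul0r.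
    rewrite /= !exprS; field.
    by rewrite xn0 expf_neq0.
  apply: is_derive_eq; rewrite /flat x0 /GRing.scale/=.
  rewrite !exprS; field.
  by rewrite xn0 expf_neq0.
(* At 0 the right difference quotient of [flat n] is [flat n.+1], which tends to 0 by [flat_le]. *)
- rewrite /flat ltxx mulr0 subr0.
  have : (fun h => h^-1 *: ((flat n \o shift 0) (h *: 1) - flat n 0)) @ 0^' --> (0 : R).
    apply/cvgrPdist_le => /= e e0.
    near=> h.
    rewrite sub0r normrN /= addr0 {2}/flat ltxx subr0 /GRing.scale /= mulr1.
    have [h0|h0] := ltP 0 h; last by rewrite /flat ltNge h0/= mulr0 normr0 ltW.
    have -> : h^-1 * flat n h = flat n.+1 h.
      rewrite /flat h0 mulrA exprS invfM. by [].
    rewrite ger0_norm ?flat_ge0//.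
    apply: le_trans (flat_le _ h0) _.
    rewrite -ler_pdivlMl ?ltr0n ?fact_gt0//.
    rewrite -(ger0_norm (ltW h0)).
    near: h. apply: dnbhs0_le. by rewrite mulr_gt0// invr_gt0 ltr0n fact_gt0.
  move=> H; apply: DeriveDef; first by apply/cvg_ex; exists 0.
  by apply/cvg_lim.
Unshelve. all: by end_near. Qed.

Inductive flat_span : (R -> R) -> Prop :=
| flat_span_base n : flat_span (flat n)
| flat_spanD f g : flat_span f -> flat_span g -> flat_span (f \+ g)
| flat_spanZ c f : flat_span f -> flat_span (fun x => c * f x).

Lemma smooth1_flat n : smooth1 (flat n).
Proof.
apply: (@smooth1_coind flat_span); last exact: flat_span_base.
move=> h; elim=> {n h} [n|f g _ [df Pf] _ [dg Pg]|c f _ [df Pf]].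
- split=> [x|]; first by have [] := is_derive_flat n x.
  suff -> : derive1 (flat n) = (flat n.+2) \+ (fun x => - n%:R * flat n.+1 x).
    by apply: flat_spanD; [|apply: flat_spanZ]; exact: flat_span_base.
  apply/funext => x /=; rewrite derive1E; have [_ ->] := is_derive_flat n x.
  by rewrite mulNr.
- split=> [x|]; first exact: derivableD.
  suff -> : derive1 (f \+ g) = (derive1 f) \+ (derive1 g) by exact: flat_spanD.
  by apply/funext => x /=; rewrite !derive1E deriveD.
- split=> [x|]; first exact: derivableZ.
  suff -> : derive1 (fun x => c * f x) = (fun x => c * (derive1 f) x) by exact: flat_spanZ.
  by apply/funext => x /=; rewrite !derive1E; exact: deriveZ.
Qed.

Lemma flat_gt0 n (x : R) : 0 < x -> 0 < flat n x.
Proof. by move=> x0; rewrite /flat x0 mulr_gt0 ?expR_gt0// invr_gt0 exprn_gt0. Qed.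

(** The quotient s(x) / (s(x) + s(1 - x)) with s(x) = e^(-1/x) for x > 0 and 0 otherwise; its
    denominator is positive because x or 1 - x is. *)
Lemma exists_smooth_step : exists sigma : R -> R,
  [/\ smooth1 sigma, forall x, x <= 0 -> sigma x = 0,
      forall x, 1 <= x -> sigma x = 1 & forall x, 0 <= sigma x <= 1].
Proof.
pose e1 (x : R) := flat 0 (-1 * x + 1).
have den_gt0 x : 0 < flat 0 x + e1 x.
  have [x0|x0] := ltP 0 x; first by rewrite ltr_pwDl// ?flat_gt0// flat_ge0.
  by rewrite ltr_pwDr// ?flat_ge0// flat_gt0//; lra.
have se1 : smooth1 e1 by apply: smooth1_affine; exact: smooth1_flat.
exists (flat 0 \* (fun x => (flat 0 x + e1 x)^-1)); split.
- apply: smooth1M; first exact: smooth1_flat.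
  apply: smooth1V => [|x]; last by rewrite gt_eqF.
  exact: (smooth1D (@smooth1_flat 0) se1).
- by move=> x x0 /=; rewrite {1}/flat ltNge x0 mul0r.
- move=> x x1 /=; rewrite [e1 x](_ : _ = 0) ?addr0 ?divff//.
    by rewrite gt_eqF// flat_gt0//; lra.
  by rewrite /e1 /flat ifF//; apply/negbTE; rewrite -leNgt; lra.
- move=> x /=; rewrite divr_ge0 ?flat_ge0 ?(ltW (den_gt0 x))//=.
  by rewrite ler_pdivrMr// mul1r lerDl flat_ge0.
Qed.

End smooth_functions_of_one_variable.

Section smooth_functions_of_two_variables.
Context {R : realType}.
Implicit Types (f g : R * R -> R) (z : R * R).

(** Along a basis vector the difference quotient is that of a one-variable slice; this reduces
    [partial] to one-variable calculus. *)
Lemma partial_quotientE (j : bool) f z :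
  (fun h => h^-1 *: ((f \o shift z) (h *: (if j then (0, 1) else (1, 0))) - f z)) =
  if j then
    (fun h => h^-1 *: (((fun s => f (z.1, s)) \o shift z.2) (h *: 1) - f (z.1, z.2)))
  else
    (fun h => h^-1 *: (((fun s => f (s, z.2)) \o shift z.1) (h *: 1) - f (z.1, z.2))).
Proof.
case: z => x y.
have E (h a b : R) : h *: (a, b) + (x, y) = (h *: (a : R^o) + x, h *: (b : R^o) + y) by [].
by case: j; apply/funext => h /=; rewrite E scaler0 add0r.
Qed.

Lemma partialE (j : bool) f z : partial j f z =
  if j then derive1 (fun s => f (z.1, s)) z.2 else derive1 (fun s => f (s, z.2)) z.1.
Proof.
by rewrite /partial /derive partial_quotientE; case: j; rewrite derive1E /derive.
Qed.

Lemma derivable_partialE (j : bool) f z :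
  derivable f z (if j then (0, 1) else (1, 0)) <->
  if j then derivable (fun s => f (z.1, s)) z.2 1
  else derivable (fun s => f (s, z.2)) z.1 1.
Proof. by rewrite /derivable partial_quotientE; case: j. Qed.

(** Continuity belongs to the invariant, since it does not follow from the existence of partial
    derivatives. *)
Lemma smooth_coind (P : (R * R -> R) -> Prop) :
  (forall f, P f -> [/\ continuous f,
     forall j z, derivable f z (if j then (0, 1) else (1, 0)) &
     forall j, P (partial j f)]) ->
  forall f, P f -> smooth f.
Proof.
(* [foldr] applies the last letter of the word first, so letters are peeled off at the end. *)
move=> HP f Pf s; elim/last_ind: s f Pf => [|s j IH] f Pf.
  have [cf df _] := HP _ Pf; split=> // z.
  by split; [exact: (df false)|exact: (df true)].
by rewrite foldr_rcons; apply: IH; have [_ _] := HP _ Pf.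
Qed.

Lemma smooth_continuous f : smooth f -> continuous f.
Proof. by move=> /(_ [::])[]. Qed.

Lemma smooth_derivable f j z : smooth f ->
  derivable f z (if j then (0, 1) else (1, 0)).
Proof.
move=> /(_ [::])[_ /(_ z)[d0 d1]]; case: j; [exact: d1|exact: d0].
Qed.

Lemma smooth_partial f j : smooth f -> smooth (partial j f).
Proof. by move=> sf s; have := sf (rcons s j); rewrite foldr_rcons. Qed.

Inductive smooth_alg : (R * R -> R) -> Prop :=
| smooth_alg_base f : smooth f -> smooth_alg f
| smooth_algD f g : smooth_alg f -> smooth_alg g -> smooth_alg (f \+ g)
| smooth_algM f g : smooth_alg f -> smooth_alg g -> smooth_alg (f \* g).

Lemma partialD f g j :
  (forall z, derivable f z (if j then (0, 1) else (1, 0))) ->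
  (forall z, derivable g z (if j then (0, 1) else (1, 0))) ->
  partial j (f \+ g) = partial j f \+ partial j g.
Proof. by move=> df dg; apply/funext => z; exact: deriveD. Qed.

Lemma partialM f g j :
  (forall z, derivable f z (if j then (0, 1) else (1, 0))) ->
  (forall z, derivable g z (if j then (0, 1) else (1, 0))) ->
  partial j (f \* g) = (f \* partial j g) \+ (g \* partial j f).
Proof. by move=> df dg; apply/funext => z; exact: deriveM. Qed.

Lemma smooth_alg_smooth f : smooth_alg f -> smooth f.
Proof.
apply: smooth_coind => {}f; elim=> {f} [f sf|f g _ [cf df Pf] _ [cg dg Pg]|].
- split=> [|j z|j]; [exact: smooth_continuous|exact: smooth_derivable|].
  exact/smooth_alg_base/smooth_partial.
- split=> [z|j z|j]; [exact: (cvgD (cf z) (cg z))|exact: (derivableD (df j z) (dg j z))|].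
  by rewrite (partialD (df j) (dg j)); exact: smooth_algD.
- move=> f g Af [cf df Pf] Ag [cg dg Pg].
  split=> [z|j z|j]; [exact: (cvgM (cf z) (cg z))|exact: (derivableM (df j z) (dg j z))|].
  by rewrite (partialM (df j) (dg j)); apply: smooth_algD; exact: smooth_algM.
Qed.

Lemma smoothD f g : smooth f -> smooth g -> smooth (f \+ g).
Proof.
by move=> sf sg; apply/smooth_alg_smooth/smooth_algD; exact: smooth_alg_base.
Qed.

Lemma smoothM f g : smooth f -> smooth g -> smooth (f \* g).
Proof.
by move=> sf sg; apply/smooth_alg_smooth/smooth_algM; exact: smooth_alg_base.
Qed.

(** The cutoffs of rectangles and the functions tested against weak gradients have this form: a
    partial derivative touches one factor only, and Fubini separates the two. *)
Definition tensor (a b : R -> R) z : R := a z.1 * b z.2.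

Lemma partial_tensor (a b : R -> R) j : smooth1 a -> smooth1 b ->
  partial j (tensor a b) = if j then tensor a (derive1 b) else tensor (derive1 a) b.
Proof.
move=> sa sb; apply/funext => z; rewrite partialE; case: j; rewrite /tensor/=.
  by rewrite derive1Ml//; exact: smooth1_derivable.
by rewrite derive1Mr//; exact: smooth1_derivable.
Qed.

Lemma smooth_tensor (a b : R -> R) : smooth1 a -> smooth1 b -> smooth (tensor a b).
Proof.
move=> sa sb; apply: (@smooth_coind (fun h => exists a b,
  [/\ smooth1 a, smooth1 b & h = tensor a b])); last by exists a, b.
move=> _ [{sa}a [{sb}b [sa sb ->]]]; split=> [z|j z|j].
- apply: (@continuousM _ _ (a \o fst) (b \o snd)).
    by apply: continuous_comp; [exact: cvg_fst|exact: smooth1_continuous].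
  by apply: continuous_comp; [exact: cvg_snd|exact: smooth1_continuous].
- apply/derivable_partialE; case: j; rewrite /tensor /=.
    by apply: derivableM; [exact: derivable_cst|exact: smooth1_derivable].
  by apply: derivableM; [exact: smooth1_derivable|exact: derivable_cst].
- rewrite partial_tensor//; case: j.
    by exists a, (derive1 b); split; [exact: sa|exact: smooth1_derive1|].
  by exists (derive1 a), b; split; [exact: smooth1_derive1|exact: sb|].
Qed.

End smooth_functions_of_two_variables.

(** * Measure on the plane *)

Section plane_measure.
Context {R : realType}.
Implicit Types (f g : R * R -> R) (z : R * R).
Notation mu := (@lebesgue_measure R).
Notation mu2 := (@lebesgue2 R).
(* The domain of [lebesgue2]. It is convertible to [R * R], but the canonical
   measurable structures of the two differ in their displays. *)
Notation P2 := (measurableTypeR R * measurableTypeR R)%type.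

Lemma exists_invn_lt (e : R) : 0 < e -> exists n, n.+1%:R^-1 < e.
Proof.
move=> e0; have [n _ /(_ n (leqnn n))] := @near_infty_natSinv_lt R (PosNum e0).
by move=> ?; exists n.
Qed.

(** An open set is the union of the countably many squares with rational centres and radii 1/(n+1)
    that it contains, and such squares are products of intervals. *)
Lemma open_measurable2 (U : set (R * R)) : open U -> @measurable _ P2 U.
Proof.
move=> oU.
pose B (i : rat * rat * nat) : set (R * R) :=
  let c := (ratr i.1.1 : R, ratr i.1.2 : R) in let e := i.2.+1%:R^-1 : R in
  if `[< ball c e `<=` U >] then ball c.1 e `*` ball c.2 e else set0.
have -> : U = \bigcup_i B i.
  apply/seteqP; split => [[x y] Uz|z [[[q r] n] _]]; last first.
    rewrite /B /=; case: ifPn => // /asboolP BU zB.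
    by apply: BU; exact: zB.
  have /nbhs_ballP[e /= e0 eU] := open_nbhs_nbhs (conj oU Uz).
  (* Radius below e/2: the small square contains (x, y) without being centred there, so the triangle
     inequality uses it twice. *)
  have [n ne] := exists_invn_lt (divr_gt0 e0 (ltr0n _ 2)).
  have n0 : 0 < n.+1%:R^-1 :> R by rewrite invr_gt0.
  have rat_near (t : R) : exists q : rat, ball (ratr q : R) n.+1%:R^-1 t.
    have /rat_in_itvoo[q] : t - n.+1%:R^-1 < t by rewrite ltrBlDr ltrDl.
    rewrite in_itv/= => /andP[q1 q2]; exists q; rewrite /ball/= ltr_norml.
    by move: q1 q2 n0; set w := (n.+1%:R^-1) => q1 q2 n0; apply/andP; split; lra.
  have [[q xq] [r yr]] := (rat_near x, rat_near y).
  exists (q, r, n) => //; rewrite /B/= ifT//; apply/asboolP => -[s t] [/= qs rt].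
  apply: eU; split=> /=.
    apply: le_ball (ball_triangle (ball_sym xq) qs).
    by rewrite [e]splitr ltW// ltrD.
  apply: le_ball (ball_triangle (ball_sym yr) rt).
  by rewrite [e]splitr ltW// ltrD.
apply: countable_bigcupT_measurable => [|i]; first exact: countableP.
by rewrite /B; case: ifPn => // _; apply: measurableX;
  exact: measurable_ball.
Qed.

Lemma continuous_measurable2 f : continuous f ->
  @measurable_fun _ _ P2 R setT f.
Proof.
move=> /continuousP cf _; apply: (measurability _ (RGenOpens.measurableE R)) => //.
move=> _ [_ [a [b ->] <-]]; rewrite setTI.
by apply: open_measurable2; apply: cf; exact: interval_open.
Qed.

Definition rect (a b c d : R) : set (R * R) := `[a, b] `*` `[c, d].

Definition box (M : R) : set (R * R) := rect (- M) M (- M) M.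

Lemma measurable_rect a b c d : @measurable _ P2 (rect a b c d).
Proof. by apply: measurableX; exact: measurable_itv. Qed.

Lemma measurable_box M : @measurable _ P2 (box M).
Proof. exact: measurable_rect. Qed.

Lemma compact_rect a b c d : compact (rect a b c d).
Proof. by apply: compact_setX; exact: segment_compact. Qed.

Lemma compact_sub_box (K : set (R * R)) : compact K -> exists M, K `<=` box M.
Proof.
move=> /compact_bounded[M [_ HM]]; exists (`|M| + 1) => z Kz.
have := HM (`|M| + 1); rewrite ltr_pwDr ?ler_norm// => /(_ isT z Kz).
rewrite /Num.norm /= ge_max => /andP[z1 z2].
by split; rewrite /= in_itv/= -ler_norml.
Qed.

Lemma lebesgue2X (A B : set (measurableTypeR R)) : measurable A -> measurable B ->
  mu2 (A `*` B) = (mu A * mu B)%E.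
Proof. by move=> mA mB; exact: product_measure1E. Qed.

Lemma lebesgue2_rect a b c d : a <= b -> c <= d ->
  mu2 (rect a b c d) = ((b - a) * (d - c))%:E.
Proof.
move=> ab cd; rewrite lebesgue2X//= !lebesgue_measure_itv/= !lte_fin.
rewrite EFinM !EFinB; congr (_ * _)%E.
  by case: ltgtP ab => // -> _; rewrite subee.
by case: ltgtP cd => // -> _; rewrite subee.
Qed.

Lemma lebesgue2_rect_lty a b c d : (mu2 (rect a b c d) < +oo)%E.
Proof.
rewrite lebesgue2X//= !lebesgue_measure_itv/=.
by case: ifP => _; case: ifP => _; rewrite ?mule0 ?mul0e// -!EFinB -EFinM ltry.
Qed.

(** Compact supports are handled from here on as vanishing off a square, which is easier to combine
    under sums and products. *)
Lemma test_functionP f : test_function f <->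
  smooth f /\ exists M, forall z, ~ box M z -> f z = 0.
Proof.
split=> [[sf cf]|[sf [M fM]]]; split; try exact: sf.
  have [M KM] := compact_sub_box cf; exists M => z nz.
  apply: contrapT => /eqP fz; apply: nz; apply: KM.
  exact: subset_closure.
apply: subclosed_compact (@compact_rect (- M) M (- M) M) _.
  exact: closed_closure.
have cl : closed (box M).
  by apply: compact_closed; [exact: norm_hausdorff|exact: compact_rect].
rewrite closureE => z; apply; split => // {}z /= /eqP fz; apply: contrapT => nz.
by apply: fz; exact: fM.
Qed.

(** The box is closed, so [f] vanishes in a whole neighbourhood of [z]. *)
Lemma partial_box_eq0 f M j z : (forall z, ~ box M z -> f z = 0) -> ~ box M z ->
  partial j f z = 0.
Proof.
move=> fM nz.
have cl : closed (box M).
  by apply: compact_closed; [exact: norm_hausdorff|exact: compact_rect].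
have := near_eq_derive (f := f) (g := cst 0) (a := z)
  (if j then (0, 1) else (1, 0)).
rewrite derive_cst; apply.
have : open_nbhs z (~` box M) by split => //; exact: closed_openC.
by move=> /open_nbhs_nbhs; apply: filterS => w /fM ->.
Qed.

End plane_measure.

(** * Plateau functions with slope of order 1/h *)

Section cutoff.
Context {R : realType}.

(** Wherever [sigma] attains its minimum 0 or its maximum 1, the derivative vanishes, the endpoints
    0 and 1 included. The bound then only concerns the compact interval between them. *)
Lemma derive1_smooth_step (sigma : R -> R) : smooth1 sigma ->
  (forall x, x <= 0 -> sigma x = 0) -> (forall x, 1 <= x -> sigma x = 1) ->
  (forall x, 0 <= sigma x <= 1) ->
  [/\ forall x, x <= 0 -> derive1 sigma x = 0,
      forall x, 1 <= x -> derive1 sigma x = 0 &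
      exists C : R, forall x, `|derive1 sigma x| <= C].
Proof.
move=> ss s0 s1 s01.
have in_ball (x : R) : x \in `]x - 1, x + 1[ by rewrite in_itv/=; apply/andP; split; lra.
have lt_ball (x : R) : x - 1 <= x + 1 by lra.
have ds (t : R) : derivable sigma t 1 by exact: smooth1_derivable.
have d0 x : x <= 0 -> derive1 sigma x = 0.
  move=> x0; rewrite derive1E.
  have [] // := @derive1_at_min R sigma _ _ x (lt_ball x) (fun t _ => ds t) (in_ball x).
  by move=> t _; rewrite (s0 x x0); have /andP[] := s01 t.
have d1 x : 1 <= x -> derive1 sigma x = 0.
  move=> x1; rewrite derive1E.
  have [] // := @derive1_at_max R sigma _ _ x (lt_ball x) (fun t _ => ds t) (in_ball x).
  by move=> t _; rewrite (s1 x x1); have /andP[] := s01 t.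
split => //.
have c1 : continuous (derive1 sigma) by apply/smooth1_continuous/smooth1_derive1.
have cn : {within `[0, 1], continuous (fun x : R => `|derive1 sigma x|)}.
  apply: continuous_subspaceT => x.
  by apply: (@continuous_comp _ _ _ (derive1 sigma) Num.norm); [exact: c1|exact: norm_continuous].
have [c _ Hc] := @EVT_max R _ 0 1 ler01 cn.
exists `|derive1 sigma c| => x.
have [x0|x0] := leP x 0; first by rewrite d0// normr0.
have [x1|x1] := leP 1 x; first by rewrite d1// normr0.
by apply: Hc; rewrite in_itv/= !ltW.
Qed.

(** The product of a rising step at [a] and a falling step at [b], both rescaled by [h]; the two
    terms of the product rule give the constant [C + C]. It is fixed before [h], which later tends
    to 0. *)
Lemma exists_cutoff : exists C : R, 0 <= C /\ forall a b h : R, 0 < h ->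
  exists alpha : R -> R,
  [/\ smooth1 alpha, forall x, 0 <= alpha x <= 1,
      forall x, ~~ (a < x < b) -> alpha x = 0 /\ derive1 alpha x = 0,
      forall x, a + h <= x <= b - h -> alpha x = 1 /\ derive1 alpha x = 0 &
      forall x, `|derive1 alpha x| <= C / h].
Proof.
have [sigma [ss s0 s1 s01]] := @exists_smooth_step R.
have [d0 d1 [C sC]] := derive1_smooth_step ss s0 s1 s01.
have C0 : 0 <= C by exact: le_trans (sC 0).
exists (C + C); split=> [|a b h h0]; first by rewrite addr_ge0.
pose s1a (x : R) := sigma (h^-1 * x + (- a / h)).
pose s2a (x : R) := sigma (- h^-1 * x + b / h).
have ss1 : smooth1 s1a by exact: smooth1_affine.
have ss2 : smooth1 s2a by exact: smooth1_affine.
have ds (x : R) : derivable sigma x 1 by exact: smooth1_derivable.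
have D x : derive1 (s1a \* s2a) x =
    h^-1 * (s2a x * derive1 sigma (h^-1 * x + (- a / h)) -
            s1a x * derive1 sigma (- h^-1 * x + b / h)).
  rewrite derive1E deriveM; try exact: smooth1_derivable.
  rewrite -!derive1E /s1a /s2a (derive1_affine (ds _)) (derive1_affine (ds _)).
  by rewrite /GRing.scale/=; ring.
have e1 x : h^-1 * x + - a / h = (x - a) / h by ring.
have e2 x : - h^-1 * x + b / h = (b - x) / h by ring.
have hV : 0 < h^-1 by rewrite invr_gt0.
exists (s1a \* s2a); split.
- exact: smooth1M.
- move=> x /=; rewrite /s1a /s2a.
  have /andP[p1 p2] := s01 (h^-1 * x + (- a / h)).
  have /andP[q1 q2] := s01 (- h^-1 * x + b / h).
  by rewrite mulr_ge0//= mulr_ile1.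
- move=> x; rewrite negb_and -!leNgt D => /orP[xa|bx]; rewrite /= /s1a /s2a !e1 !e2.
    have xa0 : (x - a) / h <= 0 by rewrite pmulr_lle0// subr_le0.
    by rewrite (s0 _ xa0) (d0 _ xa0) !mulr0 !mul0r subrr mulr0.
  have xb0 : (b - x) / h <= 0 by rewrite pmulr_lle0// subr_le0.
  by rewrite (s0 _ xb0) (d0 _ xb0) !mulr0 !mul0r subrr mulr0.
- move=> x /andP[ax xb]; rewrite D /= /s1a /s2a !e1 !e2.
  have xa1 : 1 <= (x - a) / h by rewrite ler_pdivlMr// mul1r; lra.
  have xb1 : 1 <= (b - x) / h by rewrite ler_pdivlMr// mul1r; lra.
  by rewrite (s1 _ xa1) (s1 _ xb1) (d1 _ xa1) (d1 _ xb1) !mulr0 subrr mulr0 mulr1.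
- move=> x; rewrite D normrM (gtr0_norm hV) mulrC ler_pM2r//.
  apply: le_trans (ler_normB _ _) _; rewrite !normrM.
  have B u y : `|sigma u| * `|derive1 sigma y| <= C.
    rewrite -[C]mul1r ler_pM//; have /andP[u0 u1] := s01 u.
    by rewrite ger0_norm.
  by rewrite lerD// B.
Qed.

End cutoff.

(** * Perimeter and indecomposability *)

Section perimeter_of_pieces.
Context {R : realType}.
Notation mu2 := (@lebesgue2 R).
Notation P2 := (measurableTypeR R * measurableTypeR R)%type.

Lemma bounded_integrable_box (f : R * R -> R) (M D : R) :
  @measurable_fun _ _ P2 R setT f ->
  (forall z, `|f z| <= D) -> (forall z, ~ box M z -> f z = 0) ->
  forall A : set P2, measurable A -> mu2.-integrable A (EFin \o f).
Proof.
move=> mf fD fM A mA.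
apply: (@integrableS _ _ _ _ setT) => //.
have -> : EFin \o f = (EFin \o f) \_ (box M).
  apply/funext => z; rewrite patchE; case: ifPn => // /negP zM /=.
  by rewrite fM// => /mem_set.
have [h _] := @integrable_mkcond _ _ R mu2 (box M) (EFin \o f) (measurable_box M).
apply: h.
apply: measurable_bounded_integrable; first exact: measurable_box.
- exact: lebesgue2_rect_lty.
- exact: measurable_funS mf.
- exists D; split; first exact: num_real.
  by move=> x Dx z _ /=; exact: le_trans (fD z) (ltW Dx).
Qed.

Lemma continuous_box_bounded (f : R * R -> R) (M : R) : continuous f ->
  (forall z, ~ box M z -> f z = 0) -> exists D, forall z, `|f z| <= D.
Proof.
move=> cf fM.
have := @continuous_compact _ _ f (box M).
move=> /(_ (continuous_subspaceT cf) (@compact_rect R _ _ _ _)).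
move=> /compact_bounded[D [_ HD]]; exists (`|D| + 1) => z.
have [zM|zM] := pselect (box M z); last by rewrite fM// normr0 addr_ge0.
by apply: HD; [rewrite ltr_pwDr// ler_norm|exists z].
Qed.

Lemma box_sub (M N : R) : M <= N -> box M `<=` box N.
Proof.
move=> MN z [/=]; rewrite !in_itv/= -!ler_norml => h1 h2.
by split; rewrite /= in_itv/= -ler_norml; exact: le_trans MN.
Qed.

Lemma test_functionD (f g : R * R -> R) :
  test_function f -> test_function g -> test_function (f \+ g).
Proof.
move=> /test_functionP[sf [M fM]] /test_functionP[sg [N gN]].
apply/test_functionP; split; first exact: smoothD.
exists (Num.max M N) => z nz /=.
rewrite fM ?gN ?addr0//; apply: contra_not nz; apply: box_sub; rewrite le_max lexx//.
by rewrite orbT.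
Qed.

Lemma test_functionM (f g : R * R -> R) :
  smooth g -> test_function f -> test_function (g \* f).
Proof.
move=> sg /test_functionP[sf [M fM]].
apply/test_functionP; split; first exact: smoothM.
by exists M => z nz /=; rewrite fM// mulr0.
Qed.

Lemma divergence_test (phi : R * R -> R * R) :
  test_function (fst \o phi) -> test_function (snd \o phi) ->
  [/\ exists D, forall z, `|divergence phi z| <= D &
      forall A : set P2, measurable A -> mu2.-integrable A (EFin \o divergence phi)].
Proof.
move=> /test_functionP[s1 [M1 z1]] /test_functionP[s2 [M2 z2]].
set M := Num.max M1 M2.
have z1' z : ~ box M z -> (fst \o phi) z = 0.
  by move=> nz; apply: z1; apply: contra_not nz; apply: box_sub; rewrite le_max lexx.
have z2' z : ~ box M z -> (snd \o phi) z = 0.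
  by move=> nz; apply: z2; apply: contra_not nz; apply: box_sub; rewrite le_max lexx orbT.
have cd : continuous (divergence phi).
  move=> z; apply: (@cvgD _ _ _ _ _ (partial false (fst \o phi)) (partial true (snd \o phi))).
    exact: (smooth_continuous (@smooth_partial R _ false s1) (x := z)).
  exact: (smooth_continuous (@smooth_partial R _ true s2) (x := z)).
have d0 z : ~ box M z -> divergence phi z = 0.
  move=> nz; rewrite /divergence (partial_box_eq0 _ z1')//.
  by rewrite (partial_box_eq0 _ z2')// addr0.
have [D HD] := continuous_box_bounded cd d0.
split; first by exists D.
exact: bounded_integrable_box (continuous_measurable2 cd) HD d0.
Qed.

Definition admissible (phi : R * R -> R * R) : Prop :=
  [/\ test_function (fst \o phi), test_function (snd \o phi) &
      forall x, euclid (phi x) <= 1].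

Lemma perimeter_ub (E : set (R * R)) phi : admissible phi ->
  ((\int[mu2]_(x in E) divergence phi x)%:E <= perimeter E)%E.
Proof. by move=> aphi; apply: ereal_sup_ubound; exists phi. Qed.

Lemma admissible0 : admissible (cst 0).
Proof.
have t0 : test_function (cst 0 : R * R -> R).
  apply/test_functionP; split; last by exists 0.
  have := @smooth_tensor R (cst 0) (cst 0) (@smooth1_cst R 0) (@smooth1_cst R 0).
  by congr smooth; apply/funext => z; rewrite /tensor mul0r.
split; [exact: t0|exact: t0|].
by move=> x; rewrite /euclid /= expr0n/= addr0 sqrtr0.
Qed.

Lemma perimeter_ge0 (E : set (R * R)) : (0 <= perimeter E)%E.
Proof.
apply: le_trans (perimeter_ub E admissible0).
rewrite lee_fin (_ : Rintegral _ _ _ = 0)//.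
apply: etrans (_ : \int[mu2]_(x in E) 0 = 0); last by rewrite /Rintegral integral0.
apply: eq_Rintegral => x _; rewrite /divergence /partial.
by rewrite -[fst \o _]/(cst 0) -[snd \o _]/(cst 0) !derive_cst addr0.
Qed.

(** A competitor for the union competes for both pieces. Only the reverse inequality depends on how
    the pieces touch. *)
Lemma perimeterU_le (A B : set P2) : measurable A -> measurable B ->
  A `&` B = set0 -> (perimeter (A `|` B) <= perimeter A + perimeter B)%E.
Proof.
move=> mA mB AB; apply: ub_ereal_sup => _ [phi [t1 t2 phi1] <-].
have [_ iphi] := divergence_test t1 t2.
have aphi : admissible phi by split.
rewrite Rintegral_setU//; last 2 first.
- by apply: iphi; exact: measurableU.
- by apply/disj_setPS; rewrite AB.
by rewrite EFinD leeD// perimeter_ub.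
Qed.

(** This keeps glued fields admissible. It follows from |tu + (1-t)v|^2 = t|u|^2 + (1-t)|v|^2 -
    t(1-t)|u-v|^2. *)
Lemma euclid_convex (u v : R * R) (t : R) : 0 <= t <= 1 ->
  euclid u <= 1 -> euclid v <= 1 -> euclid (t *: u + (1 - t) *: v) <= 1.
Proof.
move=> /andP[t0 t1]; rewrite /euclid.
case: u v => [u1 u2] [v1 v2] /=.
have E (s : R) : (Num.sqrt s <= 1) = (s <= 1) by rewrite -{1}sqrtr1 ler_sqrt.
rewrite !E /GRing.scale /= => hu hv.
have h0 : 0 <= t * (1 - t) * ((u1 - v1) ^+ 2 + (u2 - v2) ^+ 2).
  by rewrite !mulr_ge0 ?subr_ge0// addr_ge0 ?sqr_ge0.
have -> : (t * u1 + (1 - t) * v1) ^+ 2 + (t * u2 + (1 - t) * v2) ^+ 2 =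
    t * (u1 ^+ 2 + u2 ^+ 2) + (1 - t) * (v1 ^+ 2 + v2 ^+ 2) -
    t * (1 - t) * ((u1 - v1) ^+ 2 + (u2 - v2) ^+ 2) by ring.
rewrite lerBlDr; apply: ler_wpDr => //.
have a1 : t * (u1 ^+ 2 + u2 ^+ 2) <= t by rewrite ler_piMr.
have a2 : (1 - t) * (v1 ^+ 2 + v2 ^+ 2) <= 1 - t by rewrite ler_piMr// subr_ge0.
by apply: le_trans (lerD a1 a2) _; rewrite addrCA subrr addr0.
Qed.

Lemma euclid_le1 (u : R * R) : euclid u <= 1 -> `|u.1| <= 1 /\ `|u.2| <= 1.
Proof.
rewrite /euclid -{1}sqrtr1 ler_sqrt// => u1.
have a1 := sqr_ge0 u.1; have a2 := sqr_ge0 u.2.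
by split; rewrite ler_norml; apply/andP; split; nra.
Qed.

End perimeter_of_pieces.

(** * Cutting a set along a rectangle *)

Section perimeter_split.
Context {R : realType}.
Notation mu2 := (@lebesgue2 R).
Notation P2 := (measurableTypeR R * measurableTypeR R)%type.

Definition open_rect (a b c d : R) : set (R * R) := `]a, b[ `*` `]c, d[.

Lemma measurable_open_rect a b c d : @measurable _ P2 (open_rect a b c d).
Proof. by apply: measurableX; exact: measurable_itv. Qed.

(** This contains every point where the gradient of the product cutoff of width [h] is nonzero. *)
Definition rim (a b c d h : R) : set (R * R) :=
  open_rect a b c d `\` rect (a + h) (b - h) (c + h) (d - h).

Lemma measurable_rim a b c d h : @measurable _ P2 (rim a b c d h).
Proof.
by apply: measurableD; [exact: measurable_open_rect|exact: measurable_rect].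
Qed.

(* The field is [eta phi + (1 - eta) psi] with the cutoff [eta = alpha (x) beta]. *)
Lemma glue_divergence (phi psi : R * R -> R * R) (alpha beta : R -> R) :
  admissible phi -> admissible psi -> smooth1 alpha -> smooth1 beta ->
  (forall x, 0 <= alpha x <= 1) -> (forall x, 0 <= beta x <= 1) ->
  exists2 chi, admissible chi & forall z : R * R, divergence chi z =
    tensor alpha beta z * divergence phi z +
    (1 - tensor alpha beta z) * divergence psi z +
    (tensor (derive1 alpha) beta z * ((phi z).1 - (psi z).1) +
     tensor alpha (derive1 beta) z * ((phi z).2 - (psi z).2)).
Proof.
move=> [p1 p2 pb] [q1 q2 qb] sa sb a01 b01.
pose eta := tensor alpha beta.
(* This is 1 - eta, written with tensors so that its smoothness and partial derivatives come from
   the lemmas on [tensor]. *)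
pose theta : R * R -> R := tensor (cst 1) (cst 1) \+ tensor (\- alpha) beta.
have seta : smooth eta := smooth_tensor sa sb.
have s1 : smooth1 (@cst R R 1) := @smooth1_cst R 1.
have sNa : smooth1 (\- alpha) := smooth1N sa.
have st1 := smooth_tensor s1 s1.
have stN := smooth_tensor sNa sb.
have stheta : smooth theta := smoothD st1 stN.
have thetaE z : theta z = 1 - eta z.
  by rewrite /theta /eta /tensor /= mulr1 mulNr.
have d1 : derive1 (@cst R R 1) = cst 0.
  by apply/funext => x; rewrite derive1_cst.
have dNa : derive1 (\- alpha) = \- derive1 alpha.
  apply/funext => x; rewrite derive1E deriveN; last exact: smooth1_derivable.
  by rewrite /= derive1E.
have ptheta j z : partial j theta z = - partial j eta z.
  have dt1 := fun w => @smooth_derivable R _ j w st1.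
  have dtN := fun w => @smooth_derivable R _ j w stN.
  rewrite /theta (partialD dt1 dtN) /eta (partial_tensor _ s1 s1).
  rewrite (partial_tensor _ sNa sb) (partial_tensor _ sa sb).
  by case: (j); rewrite /tensor /= ?dNa ?d1 ?(mulr0, mul0r, add0r)/= mulNr.
pose glue (f g : R * R -> R) := (eta \* f) \+ (theta \* g).
have pglue j f g z : smooth f -> smooth g -> partial j (glue f g) z =
    eta z * partial j f z + (1 - eta z) * partial j g z + partial j eta z * (f z - g z).
  move=> sf sg.
  have df := fun w => @smooth_derivable R f j w sf.
  have dg := fun w => @smooth_derivable R g j w sg.
  have de := fun w => @smooth_derivable R eta j w seta.
  have dt := fun w => @smooth_derivable R theta j w stheta.
  rewrite /glue (partialD (fun w => derivableM (de w) (df w)) (fun w => derivableM (dt w) (dg w))).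
  by rewrite (partialM de df) (partialM dt dg) /= ptheta thetaE; ring.
exists (fun z => (glue (fst \o phi) (fst \o psi) z, glue (snd \o phi) (snd \o psi) z)).
  split.
  - by apply: test_functionD; exact: test_functionM.
  - by apply: test_functionD; exact: test_functionM.
  - move=> z.
    have := @euclid_convex R (phi z) (psi z) (eta z); rewrite -thetaE; apply.
    + have /andP[? ?] := a01 z.1; have /andP[? ?] := b01 z.2.
      by rewrite /eta /tensor mulr_ge0//= mulr_ile1.
    + exact: pb.
    + exact: qb.
move=> z.
have sp1 : smooth (fst \o phi) by case: p1.
have sp2 : smooth (snd \o phi) by case: p2.
have sq1 : smooth (fst \o psi) by case: q1.
have sq2 : smooth (snd \o psi) by case: q2.
rewrite /divergence.
rewrite -[fst \o _]/(glue (fst \o phi) (fst \o psi)).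
rewrite -[X in partial true X]/(glue (snd \o phi) (snd \o psi)).
rewrite (pglue _ _ _ _ sp1 sq1) (pglue _ _ _ _ sp2 sq2) /eta.
rewrite !(partial_tensor _ sa sb) /=; ring.
Qed.

(* Gluing across the boundary of the rectangle costs a gradient term of size
   [1/h], supported in the rim of width [h]. *)
Lemma glue_bound (phi psi : R * R -> R * R) : admissible phi -> admissible psi ->
  exists2 K : R, 0 <= K & forall (E : set P2) (a b c d h : R), measurable E ->
    0 < h <= 1 ->
    ((\int[mu2]_(z in E `&` open_rect a b c d) divergence phi z +
      \int[mu2]_(z in E `\` open_rect a b c d) divergence psi z)%:E <=
     perimeter E + (K / h)%:E * mu2 (E `&` rim a b c d h))%E.
Proof.
move=> aphi apsi.
have [p1 p2 pb] := aphi; have [q1 q2 qb] := apsi.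
have [[D1 bD1] iphi] := divergence_test p1 p2.
have [[D2 bD2] ipsi] := divergence_test q1 q2.
have [C [C0 cutoff]] := @exists_cutoff R.
have D10 : 0 <= D1 by exact: le_trans (bD1 0).
have D20 : 0 <= D2 by exact: le_trans (bD2 0).
(* On the rim, div phi - div chi is at most D1 + (D1 + D2) + 4C/h: the convex combination gives D1 +
   D2, and each partial derivative of the cutoff, at most C/h, multiplies a difference of
   components, at most 2. As h <= 1, all of it is below K/h. *)
have K0 : 0 <= 2 * D1 + D2 + 4 * C by lra.
exists (2 * D1 + D2 + 4 * C) => // E a b c d h mE /andP[h0 h1].
have [alpha [sa a01 aout ain da]] := cutoff a b h h0.
have [beta [sb b01 bout bin db]] := cutoff c d h h0.
have [chi achi divchi] := glue_divergence aphi apsi sa sb a01 b01.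
have [c1 c2 _] := achi.
have [[D3 bD3] ichi] := divergence_test c1 c2.
set Q := open_rect a b c d.
have mQ : @measurable _ P2 Q by exact: measurable_open_rect.
set S := rim a b c d h.
have mS : @measurable _ P2 S by exact: measurable_rim.
have SQ : S `<=` Q by exact: subDsetl.
have EQE : E `&` Q = (E `&` S) `|` (E `&` (Q `\` S)).
  by rewrite -setIUr setDUK.
have divchiQ : {in E `&` (Q `\` S), divergence chi =1 divergence phi}.
  move=> z /set_mem[_ [Qz nSz]].
  have : rect (a + h) (b - h) (c + h) (d - h) z.
    by apply: contrapT => nz; apply: nSz; split.
  move=> [/=]; rewrite !in_itv/= => /ain[az daz] /bin[bz dbz].
  by rewrite divchi /tensor az bz daz dbz !(mul0r, mulr0, mulr1) subrr !mul0r !addr0 mul1r.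
have divchiN : {in E `\` Q, divergence chi =1 divergence psi}.
  move=> z /set_mem[_ nQz]; rewrite divchi /tensor.
  have [z1|z1] := boolP (a < z.1 < b); last first.
    by have [-> ->] := aout _ z1; rewrite !mul0r subr0 mul1r !addr0 add0r.
  have [z2|z2] := boolP (c < z.2 < d); last first.
    by have [-> ->] := bout _ z2; rewrite !mulr0 !mul0r subr0 mul1r !addr0 add0r.
  by exfalso; apply: nQz; split; rewrite /= in_itv/=.
have dQ : [disjoint E `&` S & E `&` (Q `\` S)].
  apply/disj_setPS => z [[_ Sz] [_ [_ nSz]]]; exact: nSz.
have dE : [disjoint E `&` Q & E `\` Q].
  by apply/disj_setPS => z [[_ Qz] [_ nQz]]; exact: nQz.
have mES : @measurable _ P2 (E `&` S) by exact: measurableI.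
have mEQS : @measurable _ P2 (E `&` (Q `\` S)) by apply: measurableI => //; exact: measurableD.
have mEQ : @measurable _ P2 (E `&` Q) by exact: measurableI.
have mEnQ : @measurable _ P2 (E `\` Q) by exact: measurableD.
have Pchi := perimeter_ub E achi.
have split_int f : (forall A : set P2, measurable A -> mu2.-integrable A (EFin \o f)) ->
    \int[mu2]_(z in E `&` Q) f z =
    \int[mu2]_(z in E `&` S) f z + \int[mu2]_(z in E `&` (Q `\` S)) f z.
  move=> fi; rewrite EQE (Rintegral_setU mES mEQS _ dQ)//.
  by apply: fi; rewrite -EQE.
have int_chi : \int[mu2]_(z in E) divergence chi z =
    \int[mu2]_(z in E `&` S) divergence chi z +
    \int[mu2]_(z in E `&` (Q `\` S)) divergence phi z +
    \int[mu2]_(z in E `\` Q) divergence psi z.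
  rewrite -(eq_Rintegral _ divchiQ) -(eq_Rintegral _ divchiN) -(split_int _ ichi).
  rewrite -(Rintegral_setU mEQ mEnQ _ dE); first by rewrite setUIDK.
  by apply: ichi; exact: measurableU.
have fS : (mu2 (E `&` S) < +oo)%E.
  apply: le_lt_trans (lebesgue2_rect_lty a b c d).
  rewrite le_measure ?inE//; first exact: measurable_rect.
  move=> z [_ [[/= + +] _]]; rewrite !in_itv/= => /andP[? ?] /andP[? ?].
  by split; rewrite /= in_itv/= !ltW.
have intS : \int[mu2]_(z in E `&` S) divergence phi z -
    \int[mu2]_(z in E `&` S) divergence chi z <=
    (2 * D1 + D2 + 4 * C) / h * fine (mu2 (E `&` S)).
  rewrite -RintegralB; [|exact: mES|exact: iphi|exact: ichi].
  rewrite -Rintegral_cst//; apply: le_Rintegral => //.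
  - exact: (integrableB mES (iphi _ mES) (ichi _ mES)).
  - by apply: measurable_bounded_integrable => //; exact: bounded_cst.
  move=> z _ /=; apply: le_trans (ler_norm _) _; rewrite divchi.
  have bden : D1 <= D1 / h by rewrite ler_pdivlMr// ler_piMr.
  have bden2 : D2 <= D2 / h by rewrite ler_pdivlMr// ler_piMr.
  have [t0 t1] : 0 <= tensor alpha beta z /\ tensor alpha beta z <= 1.
    have /andP[? ?] := a01 z.1; have /andP[? ?] := b01 z.2.
    by rewrite /tensor mulr_ge0//= mulr_ile1.
  have n1 : `|tensor alpha beta z * divergence phi z| <= D1.
    by rewrite normrM -[D1]mul1r ler_pM// ger0_norm.
  have n2 : `|(1 - tensor alpha beta z) * divergence psi z| <= D2.
    by rewrite normrM -[D2]mul1r ler_pM// ger0_norm ?subr_ge0// gerBl.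
  have [u1 u2] := euclid_le1 (pb z); have [v1 v2] := euclid_le1 (qb z).
  have n3 : `|tensor (derive1 alpha) beta z * ((phi z).1 - (psi z).1)| <= C / h * 2.
    rewrite normrM ler_pM//; last first.
      by apply: le_trans (ler_normB _ _) _; rewrite -[2]/(1 + 1) lerD.
    rewrite /tensor normrM -[C / h]mulr1 ler_pM//.
    by have /andP[? ?] := b01 z.2; rewrite ger0_norm.
  have n4 : `|tensor alpha (derive1 beta) z * ((phi z).2 - (psi z).2)| <= C / h * 2.
    rewrite normrM ler_pM//; last first.
      by apply: le_trans (ler_normB _ _) _; rewrite -[2]/(1 + 1) lerD.
    rewrite /tensor normrM -[C / h]mul1r ler_pM//.
    by have /andP[? ?] := a01 z.1; rewrite ger0_norm.
  apply: le_trans (_ : D1 + (D1 + D2 + (C / h * 2 + C / h * 2)) <= _).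
    apply: le_trans (ler_normB _ _) _; apply: lerD; first exact: bD1.
    apply: le_trans (ler_normD _ _) _; apply: lerD.
      by apply: le_trans (ler_normD _ _) _; exact: lerD.
    by apply: le_trans (ler_normD _ _) _; exact: lerD.
  have -> : (2 * D1 + D2 + 4 * C) / h = 2 * (D1 / h) + D2 / h + 4 * (C / h) by ring.
  by clear - bden bden2; lra.
rewrite (split_int _ iphi).
apply: le_trans (_ : _ <= (\int[mu2]_(z in E) divergence chi z)%:E +
  ((2 * D1 + D2 + 4 * C) / h)%:E * mu2 (E `&` S))%E _; last by rewrite leeD2r.
rewrite int_chi -[mu2 (E `&` S)]fineK ?ge0_fin_numE// -EFinM -EFinD lee_fin.
have aux (p r q c' k : R) : p - c' <= k -> p + r + q <= c' + r + q + k.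
  by clear; lra.
exact: aux intS.
Qed.

End perimeter_split.

Section indecomposable_rect.
Context {R : realType}.
Notation mu2 := (@lebesgue2 R).
Notation P2 := (measurableTypeR R * measurableTypeR R)%type.

(** Independent competitors for the two pieces are glued into one for [E], at the cost of K/h times
    the measure of [E] in the rim. [K] depends on the two fields, so [h] is chosen after them; the
    suprema are then taken one at a time. *)
Lemma perimeter_split_ge (E : set P2) (a b c d : R) : measurable E ->
  (perimeter E < +oo)%E ->
  (forall e, 0 < e -> exists2 h, 0 < h <= 1 &
     (mu2 (E `&` rim a b c d h) <= (e * h)%:E)%E) ->
  (perimeter (E `&` open_rect a b c d) + perimeter (E `\` open_rect a b c d)
   <= perimeter E)%E.
Proof.
move=> mE Pfin small; set A := E `&` _; set B := E `\` _.
have PE0 := perimeter_ge0 E.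
have [p pE] : exists p, perimeter E = p%:E.
  by exists (fine (perimeter E)); rewrite fineK// ge0_fin_numE.
have key phi psi : admissible phi -> admissible psi ->
    \int[mu2]_(z in A) divergence phi z + \int[mu2]_(z in B) divergence psi z <= p.
  move=> aphi apsi; have [K K0 HK] := glue_bound aphi apsi.
  apply/ler_addgt0Pr => e e0.
  have K1 : 0 < K + 1 by rewrite ltr_wpDl.
  (* Dividing by [K + 1] instead of [K] covers [K = 0]. *)
  have [h /andP[h0 h1] hE] := small _ (divr_gt0 e0 K1).
  rewrite -lee_fin; apply: le_trans (HK E a b c d h mE _) _; first by rewrite h0.
  rewrite pE EFinD leeD2l//.
  have Kh : (0 <= (K / h)%:E)%E by rewrite lee_fin divr_ge0// ltW.
  apply: le_trans (lee_wpmul2l Kh hE) _; rewrite -EFinM lee_fin.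
  rewrite [X in X <= _](_ : _ = e * (K / (K + 1))); last first.
    by field; rewrite !gt_eqF.
  by rewrite ler_piMr ?ltW// ltr_pdivrMr// mul1r ltrDl.
have PA psi : admissible psi ->
    (perimeter A <= (p - \int[mu2]_(z in B) divergence psi z)%:E)%E.
  move=> apsi; apply: ub_ereal_sup => _ [phi aphi <-].
  by rewrite lee_fin lerBrDr; exact: key.
(* The zero field as [psi] bounds the perimeter of [A] by [p], so it is finite and can be moved
   across the inequality. *)
have [q qE] : exists q, perimeter A = q%:E.
  exists (fine (perimeter A)); rewrite fineK// ge0_fin_numE ?perimeter_ge0//.
  by apply: le_lt_trans (PA _ admissible0) _; rewrite ltry.
have PB : (perimeter B <= (p - q)%:E)%E.
  apply: ub_ereal_sup => _ [psi apsi <-].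
  by have := PA _ apsi; rewrite qE !lee_fin lerBrDr lerBrDl addrC.
by rewrite qE pE; apply: le_trans (leeD2l _ PB) _; rewrite -EFinD lee_fin addrC subrK.
Qed.

Lemma indecomposable_rect (E : set (R * R)) (a b c d : R) : indecomposable E ->
  (forall e, 0 < e -> exists2 h, 0 < h <= 1 &
     (mu2 (E `&` rim a b c d h) <= (e * h)%:E)%E) ->
  mu2 (E `&` open_rect a b c d) = 0%E \/ mu2 (E `\` open_rect a b c d) = 0%E.
Proof.
move=> [mE' PE Edec] small; have mE : @measurable _ P2 E := mE'.
have mQ : @measurable _ P2 (open_rect a b c d) by exact: measurable_open_rect.
apply: contrapT => /not_orP[nA nB]; apply: Edec.
exists (E `&` open_rect a b c d), (E `\` open_rect a b c d); split.
- split; first exact: (@measurableI _ P2 _ _ mE mQ).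
  exact: (@measurableD _ P2 _ _ mE mQ).
- by rewrite setUIDK.
- by apply/seteqP; split => // z [[_ ?] [_]].
- by split; rewrite lt0e measure_ge0 andbT; exact/eqP.
- apply/eqP; rewrite eq_le perimeter_split_ge// andbT.
  rewrite -{1}(setUIDK E (open_rect a b c d)); apply: perimeterU_le.
  + exact: measurableI.
  + exact: measurableD.
  + by apply/seteqP; split => // z [[_ ?] [_]].
Qed.

End indecomposable_rect.

(** * Slices and weak derivatives *)

Section almost_everywhere.
Context d (T : measurableType d) (R : realType) (m : {measure set T -> \bar R}).
Implicit Types P Q : T -> Prop.

Lemma aeS P Q : (forall x, P x -> Q x) ->
  {ae m, forall x, P x} -> {ae m, forall x, Q x}.
Proof. by move=> PQ; apply: filterS => x; exact: PQ. Qed.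

Lemma aeI P Q : {ae m, forall x, P x} -> {ae m, forall x, Q x} ->
  {ae m, forall x, P x /\ Q x}.
Proof. by move=> aP aQ; apply: filterS2 aP aQ => x; split. Qed.

Lemma ae_countable (I : countType) (P : I -> T -> Prop) :
  (forall i, {ae m, forall x, P i x}) -> {ae m, forall x i, P i x}.
Proof.
move=> aP.
(* Numbers that code no index carry the trivial property. *)
pose Q n x := if unpickle n is Some i then P i x else True.
have aQ n : {ae m, forall x, Q n x}.
  rewrite /Q; case: (unpickle n) => [i|]; first exact: aP.
  exact: aeW.
by apply: aeS (ae_foralln aQ) => x Qx i; have := Qx (pickle i); rewrite /Q pickleK.
Qed.

Lemma ae_mem P (A : set T) : measurable A -> (0 < m A)%E ->
  {ae m, forall x, P x} -> exists2 x, A x & P x.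
Proof.
move=> mA A0 [N [mN N0 PN]]; apply: contrapT => nex.
have AN : A `<=` N.
  by move=> x Ax; apply: PN => /= Px; apply: nex; exists x.
have : (m A <= 0)%E by rewrite -N0 le_measure ?inE.
by rewrite leNgt A0.
Qed.

Lemma integrableMr_bounded (f g : T -> R) (C : R) :
  m.-integrable setT (EFin \o f) ->
  measurable_fun setT g -> (forall x, `|g x| <= C) ->
  m.-integrable setT (EFin \o (fun x => f x * g x)).
Proof.
move=> fi mg gC.
have mf : measurable_fun setT f by apply/measurable_EFinP; case/integrableP : fi.
apply: (@le_integrable _ _ _ _ _ _ _ (fun x => C%:E * (EFin \o f) x)%E) => //.
- by apply/measurable_EFinP; exact: measurable_funM.
- move=> x _ /=; rewrite lee_fin !normrM mulrC.
  by rewrite ler_wpM2r// (le_trans (gC x)) ?ler_norm.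
- exact: integrableZl.
Qed.

Lemma ae_eq_Rintegral (f g : T -> R) : measurable_fun setT f -> measurable_fun setT g ->
  {ae m, forall x, f x = g x} -> \int[m]_x f x = \int[m]_x g x.
Proof.
move=> mf mg fg; rewrite /Rintegral; congr fine.
apply: ae_eq_integral => //; [exact/measurable_EFinP..|].
by apply: aeS fg => x fgx _; rewrite fgx.
Qed.

Lemma ae_le_Rintegral (D : set T) (f g : T -> R) : measurable D ->
  m.-integrable D (EFin \o f) -> m.-integrable D (EFin \o g) ->
  {ae m, forall x, D x -> f x <= g x} ->
  \int[m]_(x in D) f x <= \int[m]_(x in D) g x.
Proof.
move=> mD fi gi [N [mN N0 fgN]].
rewrite /Rintegral (negligible_integral mN mD fi N0) (negligible_integral mN mD gi N0).
have mDN : measurable (D `\` N) by exact: measurableD.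
apply: le_Rintegral => //.
- by apply: integrableS fi => //; exact: subDsetl.
- by apply: integrableS gi => //; exact: subDsetl.
by move=> x [Dx nNx]; apply: contrapT => fgx; apply: nNx; apply: fgN => /= /(_ Dx).
Qed.

End almost_everywhere.

(** * Lebesgue points and thin strips around a line *)

Section lebesgue_points.
Context {R : realType}.
Notation mu := (@lebesgue_measure R).
Notation mu2 := (@lebesgue2 R).
Notation P2 := (measurableTypeR R * measurableTypeR R)%type.

(** The definition without its normalisation: the ball has length 2r, so an average below e/2 means
    an integral below e r. *)
Lemma lebesgue_pt_bound (f : R -> R) (a : R) : lebesgue_pt f a ->
  forall e, 0 < e -> exists2 r0, 0 < r0 & forall r, 0 < r < r0 ->
    (\int[mu]_(y in ball a r) `|(f y - f a)%:E| <= (e * r)%:E)%E.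
Proof.
move=> /fine_cvgP[ffin fl] e e0.
have e2 : 0 < e / 2 by rewrite divr_gt0.
move/cvgrPdist_lt : fl => /(_ _ e2) fe.
have [r0 /= r00 H] : \forall r \near (0 : R)^'+,
    (davg f a r \is a fin_num) /\ (`|0 - fine (davg f a r)| < e / 2).
  by near=> r; split; near: r.
exists r0 => // r /andP[rgt0 rlt].
have [||] := H r => //=; first by rewrite sub0r normrN gtr0_norm.
move=> dfin; rewrite sub0r normrN ger0_norm ?fine_ge0 ?davg_ge0// => dlt.
have : (davg f a r <= (e / 2)%:E)%E.
  by rewrite -(fineK dfin) lee_fin ltW.
rewrite /davg /iavg (lebesgue_measure_ball _ (ltW rgt0)).
rewrite inver mulrn_eq0/= gt_eqF// => hle.
have r2 : 0 < r *+ 2 by rewrite mulrn_wgt0.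
rewrite lee_pdivrMl// in hle.
apply: le_trans hle _; rewrite -EFinM lee_fin mulr2n; lra.
Unshelve. all: by end_near. Qed.

(** Exchanging coordinates turns statements about vertical lines into statements about horizontal
    ones. *)
Definition flip (z : R * R) : R * R := (z.2, z.1).

Lemma measurable_flip : @measurable_fun _ _ P2 P2 setT flip.
Proof. exact: measurable_swap. Qed.

(** The image measure agrees with the product measure on products of measurable sets, which
    determine it. *)
Lemma lebesgue2_flip (A : set P2) : measurable A ->
  mu2 (flip @^-1` A) = mu2 A.
Proof.
move=> mA; pose fl := @mfun_Sub _ _ P2 P2 flip (mem_set measurable_flip).
apply/esym.
apply: (@product_measure_unique _ _ _ _ R mu mu (pushforward mu2 fl)) => //.
move=> B C mB mC; transitivity (mu2 (C `*` B)); last by rewrite lebesgue2X// muleC.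
by congr (mu2 _); apply/seteqP; split => -[x y] [].
Qed.

(** The measure of the slice is a locally integrable function of [a], and the strip measures its
    integral over [a - h, a + h]. At a Lebesgue point where it vanishes, this is o(h). The
    exceptional lines do not depend on which slices are null, so they can be avoided before that is
    known. *)
Lemma null_section_strip (E : set P2) (c d : R) : measurable E ->
  {ae mu, forall a, mu (xsection E a `&` `[c, d]) = 0%E ->
    forall e, 0 < e -> exists2 h0, 0 < h0 & forall h, 0 < h < h0 ->
      (mu2 (E `&` rect (a - h) (a + h) c d) <= (e * h)%:E)%E}.
Proof.
move=> mE.
pose F : set P2 := E `&` (setT `*` `[c, d]).
have mF : measurable F.
  by apply: measurableI => //; apply: measurableX => //; exact: measurable_itv.
have xF a : xsection F a = xsection E a `&` `[c, d].
  apply/seteqP; split => y; rewrite /xsection/= !inE/=; last by move=> [].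
  by move=> [? []].
have finJ : (mu `[c, d]%classic < +oo)%E.
  by rewrite lebesgue_measure_itv/=; case: ifP => _; rewrite -?EFinB ltry.
have mxE a : measurable (xsection E a) by exact: measurable_xsection.
have xF_le a : (mu (xsection F a) <= mu `[c, d]%classic)%E.
  rewrite xF le_measure ?inE//.
  by apply: measurableI => //; exact: measurable_itv.
have xF_fin a : mu (xsection F a) \is a fin_num.
  by rewrite ge0_fin_numE//; exact: le_lt_trans (xF_le a) finJ.
pose m (a : R) : R := fine (mu (xsection F a)).
have mm : @measurable_fun _ _ (measurableTypeR R) R setT m.
  apply: measurableT_comp; first exact: fine_measurable.
  exact: (measurable_fun_xsection mu mF).
have m0 a : 0 <= m a by exact: fine_ge0.
have ml : locally_integrable setT m.
  split => //; first exact: openT.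
  move=> K _ cK.
  apply: (@le_lt_trans _ _ (\int[mu]_(x in K) (cst (mu `[c, d]%classic) x))%E).
    apply: ge0_le_integral => //=; first exact: compact_measurable.
    - apply/measurable_EFinP; apply: measurableT_comp => //.
      exact: measurable_funTS.
    - by move=> x Kx; rewrite ger0_norm// fineK.
  rewrite integral_cst//; last exact: compact_measurable.
  rewrite lte_mul_pinfty//; first by rewrite ge0_fin_numE.
  exact: compact_finite_measure.
suff key (a : R) : lebesgue_pt m a -> mu (xsection E a `&` `[c, d]) = 0%E ->
    forall e : R, 0 < e -> exists2 h0, 0 < h0 & forall h, 0 < h < h0 ->
      (mu2 (E `&` rect (a - h) (a + h) c d) <= (e * h)%:E)%E.
  exact: (@aeS _ _ _ mu _ _ key (lebesgue_differentiation ml)).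
move=> la ma0 e e0.
have [r0 r00 Hr] := lebesgue_pt_bound la (divr_gt0 e0 (ltr0n _ 2)).
(* The closed interval of half-width [h] is placed in the open ball of radius [2 * h], whence the
   halves of [r0] and [e]. *)
exists (r0 / 2) => [|h /andP[h0 hr]]; first by rewrite divr_gt0.
have r2 : 0 < 2 * h < r0 by rewrite mulr_gt0//= mulrC -ltr_pdivlMr.
apply: le_trans (_ : (e / 2 * (2 * h))%:E <= _)%E; last first.
  by rewrite lee_fin mulrA divfK.
apply: le_trans (Hr _ r2).
have ma : m a = 0 by rewrite /m xF ma0.
under eq_integral do rewrite ma subr0 gee0_abs ?lee_fin// fineK//.
pose I : set R := `[a - h, a + h]%classic.
have -> : E `&` rect (a - h) (a + h) c d = F `&` (I `*` setT).
  apply/seteqP; split => -[x y] /=; first by move=> [? []].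
  by move=> [[? []]] _ ? [].
rewrite (_ : mu2 _ = \int[mu]_x (mu (xsection (F `&` (I `*` setT)) x)))%E//.
rewrite (_ : (fun x => _) = (fun x => mu (xsection F x)) \_ I).
  rewrite -integral_mkcond; apply: ge0_subset_integral => //=.
  - exact: (measurable_itv `[a - h, a + h]).
  - exact: measurable_ball.
  - by apply: measurable_funTS; exact: measurable_fun_xsection.
  - move=> x; rewrite /I /= in_itv/= /ball/= => /andP[x1 x2].
    by rewrite ltr_norml; apply/andP; split; clear - x1 x2 h0; lra.
apply/funext => x; rewrite patchE; case: ifPn => xh.
  congr (mu _); apply/seteqP; split => y; rewrite /xsection/= !inE/=; first by move=> [].
  by move=> ?; split=> //; split => //; exact: set_mem xh.
rewrite (_ : xsection _ _ = set0) ?measure0//.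
apply/seteqP; split => // y; rewrite /xsection/= inE/= => -[_ [xh' _]].
by move/negP : xh; apply; exact: mem_set.
Qed.

End lebesgue_points.

(** * Mollification by derivatives of smooth steps *)

Section mollifier.
Context {R : realType}.
Notation mu := (@lebesgue_measure R).

Definition smooth_step (sigma : R -> R) (C : R) : Prop :=
  [/\ smooth1 sigma, forall x, x <= 0 -> sigma x = 0, forall x, 1 <= x -> sigma x = 1,
      forall x, 0 <= sigma x <= 1 &
      (forall x, ~~ (0 < x < 1) -> derive1 sigma x = 0) /\
      forall x, `|derive1 sigma x| <= C].

Lemma exists_step : exists sigma C, smooth_step sigma C.
Proof.
have [sigma [ss s0 s1 s01]] := @exists_smooth_step R.
have [d0 d1 [C dC]] := derive1_smooth_step ss s0 s1 s01.
exists sigma, C; split => //; split => // x; rewrite negb_and -!leNgt.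
by case/orP; [exact: d0|exact: d1].
Qed.

(** This rises from 0 at [p] to 1 at [p + h]; its derivative is a mollifier of integral 1 and size
    C/h. *)
Definition step (sigma : R -> R) (p h x : R) : R := sigma (h^-1 * x + (- p / h)).

Variant step_spec (sigma : R -> R) (C p h : R) : Prop := StepSpec of
  smooth1 (step sigma p h) &
  (forall x, x <= p -> step sigma p h x = 0) &
  (forall x, p + h <= x -> step sigma p h x = 1) &
  (forall x, 0 <= step sigma p h x <= 1) &
  (forall x, ~~ (p < x < p + h) -> derive1 (step sigma p h) x = 0) &
  (forall x, `|derive1 (step sigma p h) x| <= C / h).

Lemma stepP sigma C p h : smooth_step sigma C -> 0 < h -> step_spec sigma C p h.
Proof.
move=> [ss s0 s1 s01 [d0 dC]] h0.
have e x : h^-1 * x + - p / h = (x - p) / h by ring.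
have ds (x : R) : derivable sigma x 1 by exact: smooth1_derivable.
have D x : derive1 (step sigma p h) x = h^-1 * derive1 sigma ((x - p) / h).
  by rewrite /step (derive1_affine (ds _)) e.
split.
- exact: smooth1_affine.
- by move=> x xp; rewrite /step e; apply: s0; rewrite pmulr_lle0 ?invr_gt0// subr_le0.
- move=> x xp; rewrite /step e; apply: s1; rewrite ler_pdivlMr// mul1r; clear - xp; lra.
- by move=> x; rewrite /step; exact: s01.
- move=> x xp; rewrite D d0 ?mulr0//; apply: contra xp => /andP[x1 x2].
  move: x1; rewrite pmulr_lgt0 ?invr_gt0// subr_gt0 => -> /=.
  by move: x2; rewrite ltr_pdivrMr// mul1r ltrBlDl.
- move=> x; rewrite D normrM gtr0_norm ?invr_gt0// mulrC ler_pM2r ?invr_gt0//.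
Qed.

Lemma measurable_continuousR (f : R -> R) : continuous f ->
  @measurable_fun _ _ (measurableTypeR R) R setT f.
Proof. by move=> cf; exact: continuous_measurable_fun. Qed.

Lemma bounded_integrable_itv (f : measurableTypeR R -> R) (a b C : R) :
  @measurable_fun _ _ (measurableTypeR R) R setT f -> (forall x, `|f x| <= C) ->
  (forall x, ~~ (a < x < b) -> f x = 0) -> mu.-integrable setT (EFin \o f).
Proof.
move=> mf fC f0; pose J : set R := `[a, b]%classic.
have mJ : @measurable _ (measurableTypeR R) J by exact: measurable_itv.
have Jfin : (mu `[a, b]%classic < +oo)%E.
  by rewrite lebesgue_measure_itv/=; case: ifP => _; rewrite -?EFinB ltry.
have -> : EFin \o f = (EFin \o f) \_ J.
  apply/funext => x; rewrite patchE; case: ifPn => // /negP xJ /=.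
  rewrite f0//; apply/negP => /andP[x1 x2]; apply: xJ.
  by rewrite inE /J /= in_itv/= !ltW.
have [h _] := @integrable_mkcond _ _ R mu J (EFin \o f) mJ.
apply: h; apply: measurable_bounded_integrable => //.
- exact: measurable_funTS.
- exists C; split; first exact: num_real.
  by move=> x Cx z _ /=; exact: le_trans (fC z) (ltW Cx).
Qed.

Lemma integral_step_kernel sigma C p h : smooth_step sigma C -> 0 < h ->
  \int[mu]_x derive1 (step sigma p h) x = 1.
Proof.
move=> sC h0; have [sst st0 st1 st01 dst0 dstC] := stepP p sC h0.
set k := derive1 _ in dst0 dstC *.
have ck : continuous k by exact/smooth1_continuous/smooth1_derive1.
have pph : p < p + h by rewrite ltrDl.
have -> : \int[mu]_x k x = \int[mu]_(x in `[p, p + h]) k x.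
  rewrite [RHS]Rintegral_mkcond; apply: eq_Rintegral => x _.
  rewrite patchE; case: ifPn => // /negP xph.
  apply: dst0; apply/negP => /andP[x1 x2]; apply: xph.
  by rewrite inE /= in_itv/= !ltW.
rewrite /Rintegral (@continuous_FTC2 R k (step sigma p h) p (p + h) pph).
- by rewrite -EFinB/= st1// st0// subr0.
- by apply: continuous_subspaceT.
- split.
  + by move=> x _; exact: smooth1_derivable.
  + by apply: cvg_at_right_filter; exact: smooth1_continuous.
  + by apply: cvg_at_left_filter; exact: smooth1_continuous.
- by move=> x _.
Qed.

(** The kernel lives in ]p, p + h[, inside the ball of radius 3h around [a], and is at most C/h
    there, so the deviation is at most C/h times the integral of |f - f a| over that ball, which is
    o(h). The freedom in [p] allows rational positions. *)
Lemma mollify_lebesgue_pt sigma C (f : R -> R) (a : R) : smooth_step sigma C ->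
  mu.-integrable setT (EFin \o f) -> lebesgue_pt f a ->
  forall e, 0 < e -> exists2 d, 0 < d & forall h p, 0 < h < d -> `|p - a| <= h ->
    `|\int[mu]_x (f x * derive1 (step sigma p h) x) - f a| <= e.
Proof.
move=> sC fi fa e e0.
have C0 : 0 <= C by case: sC => _ _ _ _ [_ /(_ 0)]; apply: le_trans.
have C1 : 0 < 3 * C + 1 by clear - C0; lra.
have [r0 r00 Hr] := lebesgue_pt_bound fa (divr_gt0 e0 C1).
exists (r0 / 3) => [|h p /andP[h0 hr] pa]; first by rewrite divr_gt0.
have [sst st0 st1 st01 dst0 dstC] := stepP p sC h0.
have ck : continuous (derive1 (step sigma p h)) by exact/smooth1_continuous/smooth1_derive1.
have ik := integral_step_kernel p sC h0.
set k := derive1 _ in dst0 dstC ck ik *.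
have mk := measurable_continuousR ck.
have r3 : 0 < 3 * h < r0 by rewrite mulr_gt0//= mulrC -ltr_pdivlMr.
have kint : mu.-integrable setT (EFin \o k) := bounded_integrable_itv mk dstC dst0.
have fk := integrableMr_bounded fi mk dstC.
have fak : mu.-integrable setT (EFin \o (fun x => f a * k x)).
  exact: (integrableZl measurableT (f a) kint).
have -> : f a = \int[mu]_x (f a * k x) by rewrite (RintegralZl _ measurableT kint) ik mulr1.
rewrite -(RintegralB measurableT fk fak) -lee_fin.
have mB : measurable (ball a (3 * h)) by exact: measurable_ball.
have mf : @measurable_fun _ _ (measurableTypeR R) R setT f.
  by apply/measurable_EFinP; case/integrableP : fi.
have fkk := integrableB measurableT fk fak.
rewrite (EFin_normr_Rintegral measurableT fkk).
apply: le_trans (le_abse_integral _ measurableT _) _; first by case/integrableP : fkk.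
have -> : (\int[mu]_x `|(f x * k x - f a * k x)%:E| =
    \int[mu]_(x in ball a (3 * h)) `|(f x * k x - f a * k x)%:E|)%E.
  rewrite [RHS]integral_mkcond; apply: eq_integral => x _; rewrite patchE.
  case: ifPn => // /negP xB; rewrite dst0 ?mulr0 ?subrr ?abse0//.
  apply/negP => /andP[x1 x2]; apply: xB; rewrite inE /ball/=.
  move: pa; rewrite ler_norml => /andP[p1 p2].
  by rewrite ltr_norml; apply/andP; split; clear - x1 x2 p1 p2 h0; lra.
apply: le_trans (_ : _ <= \int[mu]_(x in ball a (3 * h))
    ((C / h)%:E * `|(f x - f a)%:E|))%E _.
  apply: ge0_le_integral => //.
  - apply: measurable_funTS; apply: measurableT_comp => //.
    by apply/measurable_EFinP; apply: measurable_funB; exact: measurable_funM.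
  - apply: measurable_funTS; apply: emeasurable_funM => //.
    apply: measurableT_comp => //.
    by apply/measurable_EFinP; exact: measurable_funB.
  - move=> x _; rewrite -mulrBl /= -EFinM lee_fin normrM mulrC ler_wpM2r//.
have Ch0 : 0 <= C / h by rewrite divr_ge0// ltW.
rewrite ge0_integralZl//; last first.
  apply: measurable_funTS; apply: measurableT_comp => //.
  by apply/measurable_EFinP; exact: measurable_funB.
apply: le_trans (lee_wpmul2l _ (Hr _ r3)) _; first by rewrite lee_fin.
rewrite -EFinM lee_fin.
have -> : C / h * (e / (3 * C + 1) * (3 * h)) = e * ((3 * C) / (3 * C + 1)).
  by field; rewrite !gt_eqF.
by rewrite ler_piMr ?ltW// ltr_pdivrMr// mul1r; clear; lra.
Qed.

End mollifier.

(** * Weak derivatives on almost every line *)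

Section slices.
Context {R : realType}.
Notation mu := (@lebesgue_measure R).
Notation mu2 := (@lebesgue2 R).
Notation P2 := (measurableTypeR R * measurableTypeR R)%type.
Notation T1 := (measurableTypeR R).

Lemma slice_integrable (f : P2 -> R) : mu2.-integrable setT (EFin \o f) ->
  [/\ {ae mu, forall x, mu.-integrable setT (EFin \o (fun y => f (x, y)))},
      mu.-integrable setT (EFin \o (fun x => \int[mu]_y f (x, y))) &
      \int[mu]_x (\int[mu]_y f (x, y)) = \int[mu2]_z f z].
Proof.
move=> fi.
have ae1 := @ae_integrable1 _ _ T1 T1 R mu mu _ fi.
have iF := @integrable_fubini_F _ _ T1 T1 R mu mu _ fi.
have EF := @integral12_prod_meas1 _ _ T1 T1 R mu mu _ fi.
set F := fubini_F _ _ in iF EF.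
have mF : measurable_fun setT F by case/integrableP : iF.
have mfF : @measurable_fun _ _ T1 R setT (fine \o F).
  by apply: measurableT_comp => //; exact: fine_measurable.
have iFr : mu.-integrable setT (EFin \o (fun x => \int[mu]_y f (x, y))).
  apply: le_integrable iF => //; first exact/measurable_EFinP.
  (* [fine] sends infinite values to 0, so it never increases the absolute value. *)
  move=> x _; rewrite /Rintegral /=.
  rewrite -[X in fine X]/(F x); by case: (F x) => [r| |]; rewrite /= ?lexx ?leey.
split => //.
rewrite /Rintegral; congr fine; rewrite -EF.
apply: ae_eq_integral => //; first exact/measurable_EFinP.
apply: (@aeS _ _ _ mu _ _ _ ae1) => x /= xi _.
by rewrite -/(F x) fineK//; exact: integrable_fin_num.
Qed.

Lemma ae_xsection (B : set P2) : measurable B ->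
  {ae mu, forall x, mu (xsection B x) = 0%E} -> mu2 B = 0%E.
Proof.
move=> mB xB; rewrite (_ : mu2 B = \int[mu]_x mu (xsection B x))%E//.
rewrite -(@integral0 _ _ _ mu setT); apply: ae_eq_integral => //.
  exact: measurable_fun_xsection.
by move: xB; apply: (@aeS _ _ _ mu) => x xB _; rewrite xB.
Qed.

Lemma xsection_ae (B : set P2) : measurable B -> mu2 B = 0%E ->
  {ae mu, forall x, mu (xsection B x) = 0%E}.
Proof.
move=> mB; rewrite (_ : mu2 B = \int[mu]_x mu (xsection B x))%E// => xB.
have mx : measurable_fun setT (fun x : T1 => mu (xsection B x)).
  exact: measurable_fun_xsection.
have /(ae_eq_integral_abs mu measurableT mx) : (\int[mu]_x `|mu (xsection B x)| = 0)%E.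
  by rewrite -xB; apply: eq_integral => x _; rewrite gee0_abs.
by apply: (@aeS _ _ _ mu) => x /(_ I).
Qed.

(* [w] is the weak derivative of [g] in the second variable, tested against
   products [alpha (x) beta] supported in []-N, N[ x ]c, d[]. *)
Definition tensor_weak (g w : P2 -> R) (N c d : R) : Prop :=
  forall alpha beta, smooth1 alpha -> smooth1 beta ->
    (forall x, ~~ (- N < x < N) -> alpha x = 0) ->
    (forall y, ~~ (c < y < d) -> beta y = 0) ->
    \int[mu2]_z (g z * tensor alpha (derive1 beta) z + w z * tensor alpha beta z) = 0.

Lemma measurable_comp_fst (f : R -> R) : @measurable_fun _ _ T1 R setT f ->
  @measurable_fun _ _ P2 R setT (fun z => f z.1).
Proof. by move=> mf; apply: (measurableT_comp mf); exact: measurable_fst. Qed.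

Lemma measurable_comp_snd (f : R -> R) : @measurable_fun _ _ T1 R setT f ->
  @measurable_fun _ _ P2 R setT (fun z => f z.2).
Proof. by move=> mf; apply: (measurableT_comp mf); exact: measurable_snd. Qed.

(** By Fubini, the slice integral F is orthogonal to every admissible [alpha]; taking for [alpha] a
    mollifier at a Lebesgue point gives F = 0 there. The exceptional set depends on [beta], so this
    may only be combined over countably many of them. *)
Lemma slice_weak (g w : P2 -> R) (N c d C1 C2 : R) (beta : R -> R) :
  mu2.-integrable setT (EFin \o g) -> mu2.-integrable setT (EFin \o w) ->
  tensor_weak g w N c d -> smooth1 beta ->
  (forall y, ~~ (c < y < d) -> beta y = 0) ->
  (forall y, `|beta y| <= C1) -> (forall y, `|derive1 beta y| <= C2) ->
  {ae mu, forall x, - N < x < N ->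
     \int[mu]_y (g (x, y) * derive1 beta y + w (x, y) * beta y) = 0}.
Proof.
move=> gi wi H sb b0 bC1 bC2.
have mb := measurable_continuousR (smooth1_continuous sb).
have mdb := measurable_continuousR (smooth1_continuous (smooth1_derive1 sb)).
pose f (z : P2) := g z * derive1 beta z.2 + w z * beta z.2.
have fi : mu2.-integrable setT (EFin \o f).
  have i1 := integrableMr_bounded gi (measurable_comp_snd mdb) (fun z => bC2 z.2).
  have i2 := integrableMr_bounded wi (measurable_comp_snd mb) (fun z => bC1 z.2).
  exact: (integrableD measurableT i1 i2).
have [aef iF _] := slice_integrable fi.
set F := fun x => \int[mu]_y f (x, y) in iF.
have mF : @measurable_fun _ _ T1 R setT F.
  by apply/measurable_EFinP; case/integrableP : iF.
have Fl : locally_integrable setT F.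
  by apply: open_integrable_locally => //; exact: openT.
have [sigma [C sC]] := @exists_step R.
suff key (x : R) : lebesgue_pt F x -> - N < x < N -> F x = 0.
  exact: (@aeS _ _ _ mu _ _ key (lebesgue_differentiation Fl)).
move=> Fx /andP[xN1 xN2]; apply/eqP; rewrite -normr_le0; apply/ler_addgt0Pr => e e0.
rewrite add0r.
have [dl dl0 Hd] := mollify_lebesgue_pt sC iF Fx e0.
(* The kernel lies to the right of [x], so its support stays in ]- N, N[ once x + h < N. *)
have [h [h0 hd hN]] : exists h, [/\ 0 < h, h < dl & x + h < N].
  have m0 : 0 < Num.min dl (N - x) by rewrite lt_min dl0 subr_gt0.
  exists (Num.min dl (N - x) / 2); split; first by rewrite divr_gt0.
    rewrite ltr_pdivrMr//; apply: (@le_lt_trans _ _ dl); first by rewrite ge_min lexx.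
    by clear - dl0; lra.
  rewrite -ltrBrDl ltr_pdivrMr//; apply: (@le_lt_trans _ _ (N - x)).
    by rewrite ge_min lexx orbT.
  by clear - xN2; lra.
have := Hd h x; rewrite h0 hd subrr normr0 ltW// => /(_ isT isT).
have [sst st0 st1 st01 dst0 dstC] := stepP x sC h0.
set k := derive1 _ in dst0 dstC *.
have sk : smooth1 k := smooth1_derive1 sst.
have mk := measurable_continuousR (smooth1_continuous sk).
suff -> : \int[mu]_x (F x * k x) = 0 by rewrite sub0r normrN.
have fki := integrableMr_bounded fi (measurable_comp_fst mk) (fun z => dstC z.1).
have [_ iFk Efk] := slice_integrable fki.
have -> : \int[mu]_x (F x * k x) = \int[mu]_x \int[mu]_y (f (x, y) * k (x, y).1).
  apply: ae_eq_Rintegral.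
  - exact: measurable_funM.
  - by apply/measurable_EFinP; case/integrableP : iFk.
  - by move: aef; apply: (@aeS _ _ _ mu) => y /= fy; rewrite /F RintegralZr.
rewrite Efk -(H k beta sk sb) //.
  by apply: eq_Rintegral => z _; rewrite /f /tensor; ring.
move=> y yN; apply: dst0; apply: contra yN => /andP[y1 y2].
by rewrite (lt_trans xN1 y1) (lt_trans y2 hN).
Qed.

End slices.

(** * Oscillation along a line bounded by the integral of the derivative *)

Section oscillation_on_slices.
Context {R : realType}.
Notation mu := (@lebesgue_measure R).
Notation mu2 := (@lebesgue2 R).
Notation P2 := (measurableTypeR R * measurableTypeR R)%type.
Notation T1 := (measurableTypeR R).

Definition step_diff (sigma : R -> R) (p q h : R) : R -> R :=
  step sigma p h \- step sigma q h.

Variant step_diff_spec (sigma : R -> R) (C c d p q h : R) : Prop := StepDiffSpec of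
  smooth1 (step_diff sigma p q h) &
  (forall x, ~~ (c < x < d) -> step_diff sigma p q h x = 0) &
  (forall x, `|step_diff sigma p q h x| <= 1) &
  (forall x, `|derive1 (step_diff sigma p q h) x| <= C / h + C / h) &
  (forall x, derive1 (step_diff sigma p q h) x =
     derive1 (step sigma p h) x - derive1 (step sigma q h) x).

Lemma step_diffP sigma C c d p q h : smooth_step sigma C -> 0 < h ->
  c <= p -> c <= q -> p + h <= d -> q + h <= d -> step_diff_spec sigma C c d p q h.
Proof.
move=> sC h0 cp cq pd qd.
have [ssp p0 p1 p01 dp0 dpC] := stepP p sC h0.
have [ssq q0 q1 q01 dq0 dqC] := stepP q sC h0.
have D x : derive1 (step_diff sigma p q h) x =
     derive1 (step sigma p h) x - derive1 (step sigma q h) x.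
  by rewrite derive1E deriveB ?derive1E//; exact: smooth1_derivable.
split; last exact: D.
- exact: (smooth1B ssp ssq).
- move=> x; rewrite negb_and -!leNgt /step_diff/= => /orP[xc|dx].
    by rewrite p0 ?q0 ?subrr//; [exact: le_trans cq|exact: le_trans cp].
  by rewrite p1 ?q1 ?subrr//; [exact: le_trans dx|exact: le_trans dx].
- move=> x; rewrite /step_diff/=; have /andP[a0 a1] := p01 x; have /andP[b0 b1] := q01 x.
  by rewrite ler_norml; apply/andP; split; clear - a0 a1 b0 b1; lra.
- by move=> x; rewrite D; apply: le_trans (ler_normB _ _) _; exact: lerD.
Qed.

(* Testing with a difference of two steps at [y] and [z], whose derivative is a
   difference of mollifiers, compares [u y] and [u z] at Lebesgue points. *)
Lemma slice_osc1 sigma C (u v : T1 -> R) (c d : R) : smooth_step sigma C ->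
  mu.-integrable setT (EFin \o u) -> mu.-integrable setT (EFin \o v) ->
  (forall (p q : rat) n, let h := n.+1%:R^-1 in
     c <= ratr p -> c <= ratr q -> ratr p + h <= d -> ratr q + h <= d ->
     \int[mu]_t (u t * derive1 (step_diff sigma (ratr p) (ratr q) h) t +
                 v t * step_diff sigma (ratr p) (ratr q) h t) = 0) ->
  forall y z : R, c < y < d -> c < z < d -> lebesgue_pt u y -> lebesgue_pt u z ->
    `|u y - u z| <= \int[mu]_(t in `[c, d]) `|v t|.
Proof.
move=> sC ui vi H y z /andP[cy yd] /andP[cz zd] uy uz.
apply/ler_addgt0Pr => e e0.
have e2 : 0 < e / 2 by rewrite divr_gt0.
have [dy dy0 Hy] := mollify_lebesgue_pt sC ui uy e2.
have [dz dz0 Hz] := mollify_lebesgue_pt sC ui uz e2.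
(* A rational p in ]y, y + h[ satisfies p + h < y + 2h, which must stay below [d]; likewise for
   [z]. *)
have m0 : 0 < Num.min (Num.min dy dz) (Num.min ((d - y) / 2) ((d - z) / 2)).
  by rewrite !lt_min dy0 dz0 !divr_gt0// subr_gt0.
have [n] := exists_invn_lt m0; rewrite !lt_min => /andP[/andP[ny nz] /andP[nyd nzd]].
set h := n.+1%:R^-1 in ny nz nyd nzd.
have h0 : 0 < h by rewrite invr_gt0.
have /rat_in_itvoo[p] : y < y + h by rewrite ltrDl.
rewrite in_itv/= => /andP[yp ph].
have /rat_in_itvoo[q] : z < z + h by rewrite ltrDl.
rewrite in_itv/= => /andP[zq qh].
have cp : c <= ratr p by rewrite ltW// (lt_trans cy).
have cq : c <= ratr q by rewrite ltW// (lt_trans cz).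
have pd : ratr p + h <= d by clear - ph nyd; lra.
have qd : ratr q + h <= d by clear - qh nzd; lra.
have := H p q n cp cq pd qd; rewrite -/h.
have [ssp p0 p1 p01 dp0 dpC] := stepP (ratr p) sC h0.
have [ssq q0 q1 q01 dq0 dqC] := stepP (ratr q) sC h0.
have [sb b0 b1 dbC dbE] := step_diffP sC h0 cp cq pd qd.
have mb := measurable_continuousR (smooth1_continuous sb).
have mkp := measurable_continuousR (smooth1_continuous (smooth1_derive1 ssp)).
have mkq := measurable_continuousR (smooth1_continuous (smooth1_derive1 ssq)).
have iup := integrableMr_bounded ui mkp dpC.
have iuq := integrableMr_bounded ui mkq dqC.
have ivb := integrableMr_bounded vi mb b1.
have -> : \int[mu]_t (u t * derive1 (step_diff sigma (ratr p) (ratr q) h) t +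
      v t * step_diff sigma (ratr p) (ratr q) h t) =
    \int[mu]_t (u t * derive1 (step sigma (ratr p) h) t) -
    \int[mu]_t (u t * derive1 (step sigma (ratr q) h) t) +
    \int[mu]_t (v t * step_diff sigma (ratr p) (ratr q) h t).
  rewrite -(RintegralB measurableT iup iuq).
  rewrite -(RintegralD measurableT (integrableB measurableT iup iuq) ivb).
  by apply: eq_Rintegral => t _; rewrite dbE; ring.
have Hyp : `|\int[mu]_t (u t * derive1 (step sigma (ratr p) h) t) - u y| <= e / 2.
  apply: Hy; first by rewrite h0.
  by rewrite ger0_norm ?subr_ge0 ?ltW// ltrBlDl.
have Hzq : `|\int[mu]_t (u t * derive1 (step sigma (ratr q) h) t) - u z| <= e / 2.
  apply: Hz; first by rewrite h0.
  by rewrite ger0_norm ?subr_ge0 ?ltW// ltrBlDl.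
have Hv : `|\int[mu]_t (v t * step_diff sigma (ratr p) (ratr q) h t)| <=
    \int[mu]_(t in `[c, d]) `|v t|.
  apply: le_trans (le_normr_Rintegral measurableT ivb) _.
  rewrite [leRHS]Rintegral_mkcond; apply: le_Rintegral => //.
  - exact: integrable_norm.
  - pose J : set R := `[c, d]%classic.
    have mJ : @measurable _ T1 J by exact: measurable_itv.
    rewrite (_ : EFin \o _ = (EFin \o (fun t => `|v t|)) \_ J); last first.
      by apply/funext => t; rewrite /= !patchE; case: ifPn.
    have [hJ _] := @integrable_mkcond _ _ R mu J (EFin \o (fun t => `|v t|)) mJ.
    apply: hJ; apply: (@integrableS _ _ _ _ setT) => //.
    exact: integrable_norm.
  move=> t _; rewrite patchE; case: ifPn => [_|/negP tcd].
    by rewrite normrM ler_piMr.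
  rewrite b0 ?mulr0 ?normr0//; apply/negP => /andP[t1 t2]; apply: tcd.
  by rewrite inE /= in_itv/= !ltW.
move: Hyp Hzq Hv; set I1 := Rintegral _ _ _; set I2 := Rintegral _ _ _.
set I3 := Rintegral _ _ _; set I4 := Rintegral _ _ _.
move: I1 I2 I3 I4 (u y) (u z) => I1 I2 I3 I4 uy' uz'; clear.
rewrite !ler_norml => /andP[a1 a2] /andP[b1 b2] /andP[c1 c2] E.
by apply/andP; split; lra.
Qed.

(** Steps at rational points with widths 1/(n+1) form a countable family, so one null set of lines
    serves all of them, and hence all pairs of Lebesgue points. *)
Lemma slice_osc (g w : P2 -> R) (N c d : R) :
  mu2.-integrable setT (EFin \o g) -> mu2.-integrable setT (EFin \o w) ->
  tensor_weak g w N c d ->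
  {ae mu, forall x, - N < x < N -> forall y z : R, c < y < d -> c < z < d ->
    lebesgue_pt (fun t => g (x, t)) y -> lebesgue_pt (fun t => g (x, t)) z ->
    `|g (x, y) - g (x, z)| <= \int[mu]_(t in `[c, d]) `|w (x, t)|}.
Proof.
move=> gi wi H.
have [sigma [C sC]] := @exists_step R.
have [aeg _ _] := slice_integrable gi.
have [aew _ _] := slice_integrable wi.
pose I := ((rat * rat) * nat)%type.
pose h (i : I) : R := i.2.+1%:R^-1.
pose b (i : I) := step_diff sigma (ratr i.1.1) (ratr i.1.2) (h i).
pose inside (i : I) := [&& c <= ratr i.1.1, c <= ratr i.1.2,
  ratr i.1.1 + h i <= d & ratr i.1.2 + h i <= d].
have aeH : {ae mu, forall (x : R) (i : I), inside i -> - N < x < N ->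
    \int[mu]_t (g (x, t) * derive1 (b i) t + w (x, t) * b i t) = 0}.
  apply: ae_countable => i.
  have [/and4P[i1 i2 i3 i4]|ni] := boolP (inside i); last exact: aeW.
  have hi0 : 0 < h i by rewrite invr_gt0.
  have [sb b0 b1 dbC _] := step_diffP sC hi0 i1 i2 i3 i4.
  have := slice_weak gi wi H sb b0 b1 dbC.
  by apply: (@aeS _ _ _ mu) => x Hx _.
have := @aeI _ _ _ mu _ _ (@aeI _ _ _ mu _ _ aeg aew) aeH.
apply: (@aeS _ _ _ mu) => x [[gx wx] Hx] xN y z ycd zcd.
apply: (slice_osc1 sC gx wx) => // p q n hn cp cq pd qd.
by apply: (Hx (p, q, n)) => //; apply/and4P; split.
Qed.

End oscillation_on_slices.

(** * Deviation from the average over a line *)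

Section product_oscillation.
Context {R : realType}.
Notation mu := (@lebesgue_measure R).
Notation mu2 := (@lebesgue2 R).
Notation P2 := (measurableTypeR R * measurableTypeR R)%type.
Notation T1 := (measurableTypeR R).

Lemma slice_integral_on (f : P2 -> R) (I K : set T1) :
  measurable I -> measurable K -> mu2.-integrable setT (EFin \o f) ->
  mu.-integrable setT (EFin \o (fun x => \int[mu]_(y in K) f (x, y))) /\
  \int[mu]_(x in I) (\int[mu]_(y in K) f (x, y)) = \int[mu2]_(z in I `*` K) f z.
Proof.
move=> mI mK fi.
have restr (A : set T1) : measurable A ->
    [/\ mu.-integrable setT (EFin \o ((fun x => \int[mu]_(y in K) f (x, y)) \_ A)) &
     \int[mu]_x ((fun x => \int[mu]_(y in K) f (x, y)) \_ A) x =
     \int[mu2]_(z in A `*` K) f z].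
  move=> mA.
  have mAK : @measurable _ P2 (A `*` K) by exact: measurableX.
  have fAK : mu2.-integrable setT (EFin \o (f \_ (A `*` K))).
    rewrite (_ : EFin \o _ = (EFin \o f) \_ (A `*` K)); last first.
      by apply/funext => t; rewrite /= !patchE; case: ifPn.
    have [h _] := @integrable_mkcond _ _ R mu2 (A `*` K) (EFin \o f) mAK.
    by apply: h; apply: integrableS fi.
  have [_ iF EF] := slice_integrable fAK.
  have E : (fun x => \int[mu]_(y in K) f (x, y)) \_ A =
      fun x => \int[mu]_y (f \_ (A `*` K)) (x, y).
    apply/funext => x; rewrite patchE; case: ifPn => xA.
      rewrite Rintegral_mkcond; apply: eq_Rintegral => y _; rewrite !patchE.
      congr (if _ then _ else _); apply/idP/idP; rewrite !inE.
        by move=> yK; split => //; exact: set_mem.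
      by case.
    rewrite -[LHS](Rintegral_set0 mu (fun=> 0)) Rintegral_mkcond.
    apply: eq_Rintegral => y _; rewrite !patchE in_set0; case: ifPn => //.
    by rewrite inE => -[/= /mem_set]; rewrite (negbTE xA).
  by rewrite E; split => //; rewrite EF [RHS]Rintegral_mkcond.
split; last by rewrite [LHS]Rintegral_mkcond; have [] := restr I mI.
by have [+ _] := restr setT measurableT; rewrite patch_setT.
Qed.

Lemma lebesgue_measure_oo (a b : R) : a < b -> mu `]a, b[%classic = (b - a)%:E.
Proof. by move=> ab; rewrite lebesgue_measure_itv/= lte_fin ab. Qed.

Lemma average_dev (u : T1 -> R) (c d W y : R) : c < d ->
  mu.-integrable setT (EFin \o u) ->
  {ae mu, forall t : R, c < t < d -> `|u y - u t| <= W} ->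
  `|u y - (d - c)^-1 * \int[mu]_(t in `]c, d[) u t| <= W.
Proof.
move=> cd ui uW.
have dc : 0 < d - c by rewrite subr_gt0.
pose J : set T1 := `]c, d[%classic.
have mJ : measurable J by exact: measurable_itv.
have uJ : mu.-integrable J (EFin \o u) by apply: integrableS ui.
have muJ : mu J = (d - c)%:E := lebesgue_measure_oo cd.
have finJ : (mu J < +oo)%E by rewrite muJ ltry.
have cJ (k : R) : mu.-integrable J (EFin \o cst k).
  by apply: measurable_bounded_integrable => //; exact: bounded_cst.
have EC (k : R) : \int[mu]_(t in J) (cst k) t = k * (d - c).
  rewrite Rintegral_cst//; congr (k * _); exact: (congr1 (@fine R) muJ).
have up : \int[mu]_(t in J) u t <= (u y + W) * (d - c).
  rewrite -EC; apply: ae_le_Rintegral => //.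
  apply: (@aeS _ _ _ mu) uW => t ut; rewrite /J/= in_itv/= => /ut.
  by rewrite ler_norml => /andP[h1 h2]; clear - h1; lra.
have lo : (u y - W) * (d - c) <= \int[mu]_(t in J) u t.
  rewrite -EC; apply: ae_le_Rintegral => //.
  apply: (@aeS _ _ _ mu) uW => t ut; rewrite /J/= in_itv/= => /ut.
  by rewrite ler_norml => /andP[h1 h2]; clear - h2; lra.
rewrite -/J; set I := Rintegral _ _ _ in up lo *.
have -> : u y - (d - c)^-1 * I = ((d - c) * u y - I) / (d - c).
  by field; rewrite gt_eqF.
move: (u y) I up lo => v I up lo.
rewrite normrM [`|_^-1|]gtr0_norm ?invr_gt0// ler_pdivrMr// ler_norml.
by apply/andP; split; clear - up lo; lra.
Qed.

(** Replacing one of the two points of the oscillation bound by the average over the line leaves a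
    condition on a single point. Its failure set is measurable in the plane, hence null by
    Fubini. *)
Lemma slice_average_dev (g w : P2 -> R) (N c d : R) : c < d ->
  mu2.-integrable setT (EFin \o g) -> mu2.-integrable setT (EFin \o w) ->
  tensor_weak g w N c d ->
  let A x := (d - c)^-1 * \int[mu]_(t in `]c, d[) g (x, t) in
  let W x := \int[mu]_(t in `[c, d]) `|w (x, t)| in
  exists B : set P2, [/\ measurable B, mu2 B = 0%E &
    forall z, ~ B z -> - N < z.1 < N -> c < z.2 < d -> `|g z - A z.1| <= W z.1].
Proof.
move=> cd gi wi H A W.
have mg : @measurable_fun _ _ P2 R setT g.
  by apply/measurable_EFinP; case/integrableP : gi.
pose J : set R := `]c, d[%classic.
pose K : set R := `[c, d]%classic.
pose I : set R := `]- N, N[%classic.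
have mA : @measurable_fun _ _ T1 R setT A.
  have [+ _] := @slice_integral_on g setT J measurableT (measurable_itv _) gi.
  by move=> /integrableP[/measurable_EFinP mA _]; exact: measurable_funM.
have mW : @measurable_fun _ _ T1 R setT W.
  have [+ _] := @slice_integral_on (fun z => `|w z|) setT K measurableT
    (measurable_itv _) (integrable_norm wi).
  by move=> /integrableP[/measurable_EFinP].
pose bad (z : P2) := `|g z - A z.1| - W z.1.
have mbad : @measurable_fun _ _ P2 R setT bad.
  apply: measurable_funB; last exact: measurable_comp_fst.
  apply: measurableT_comp => //; apply: measurable_funB => //.
  exact: measurable_comp_fst.
pose B : set P2 := (bad @^-1` `]0, +oo[) `&` (I `*` J).
have mB : measurable B.
  apply: measurableI; first by rewrite -[X in measurable X]setTI; exact: mbad.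
  by apply: measurableX; exact: measurable_itv.
exists B; split => //; last first.
  move=> z nB zN zcd; rewrite leNgt; apply/negP => lt; apply: nB; split.
    by rewrite /= in_itv/= andbT subr_gt0.
  by split; rewrite /I/J/= in_itv.
apply: ae_xsection => //.
have [aeg _ _] := slice_integrable gi.
have := @aeI _ _ _ mu _ _ aeg (slice_osc gi wi H).
apply: (@aeS _ _ _ mu) => x [gx Hx].
have [xN|xN] := boolP (- N < x < N); last first.
  rewrite (_ : xsection B x = set0) ?measure0//.
  apply/seteqP; split => // y; rewrite /xsection/= inE => -[_ [/= + _]].
  by rewrite /I /= in_itv/= (negbTE xN).
pose u : T1 -> R := fun t => g (x, t).
have ul : {ae mu, forall t : R, lebesgue_pt u t}.
  apply: lebesgue_differentiation; apply: open_integrable_locally => //.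
  exact: openT.
(* The slice of [B] over this [x] consists of points that are not Lebesgue points of [u]. *)
have [N0 [mN0 N00 uN]] := ul.
apply/eqP; rewrite -measure_le0 -N00.
have mxB : measurable (xsection B x) by exact: measurable_xsection.
rewrite le_measure ?inE// => y; rewrite /xsection/= inE => -[/= + [_ /=]].
rewrite !in_itv/= andbT subr_gt0 => lt ycd.
apply: uN => /= uy; move: lt; rewrite ltNge => /negP; apply.
apply: (@average_dev u) => //.
move: ul; apply: (@aeS _ _ _ mu) => t ut tcd.
exact: (Hx xN y t ycd tcd uy ut).
Qed.

End product_oscillation.

(** * Weak gradients tested on products *)

Section tensor_weak_gradient.
Context {R : realType}.
Notation mu := (@lebesgue_measure R).
Notation mu2 := (@lebesgue2 R).
Notation P2 := (measurableTypeR R * measurableTypeR R)%type.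
Notation T1 := (measurableTypeR R).

Lemma Rintegral_flip (F : P2 -> R) : mu2.-integrable setT (EFin \o F) ->
  mu2.-integrable setT (EFin \o (F \o @flip R)) /\
  \int[mu2]_z F (flip z) = \int[mu2]_z F z.
Proof.
move=> iF.
have mF : @measurable_fun _ _ P2 R setT F.
  by apply/measurable_EFinP; case/integrableP : iF.
have mfl := @measurable_flip R.
pose fl := @mfun_Sub _ _ P2 P2 (@flip R) (mem_set mfl).
have inv (G : P2 -> \bar R) :
    (\int[pushforward mu2 fl]_z G z = \int[mu2]_z G z)%E.
  apply: (@eq_measure_integral _ P2 R setT mu2) => A mA _.
  exact: (@lebesgue2_flip R A mA).
have mFf : @measurable_fun _ _ P2 R setT (F \o @flip R).
  exact: (measurableT_comp mF mfl).
have iFf : mu2.-integrable setT (EFin \o (F \o @flip R)).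
  apply/integrableP; split; first exact/measurable_EFinP.
  case/integrableP : iF => _; apply: le_lt_trans.
  rewrite -[leRHS]inv.
  rewrite (@ge0_integral_pushforward _ _ P2 P2 R fl mfl mu2 setT)//.
  by apply/measurable_EFinP; exact: measurableT_comp.
split => //; rewrite /Rintegral -[in RHS]inv.
by rewrite (@integral_pushforward _ _ P2 P2 R fl mfl mu2 setT)//; exact/measurable_EFinP.
Qed.

Lemma restrict_box_integrable (f : R * R -> R) N : Defs.locally_integrable f ->
  mu2.-integrable setT (EFin \o (f \_ (box N))).
Proof.
move=> [mf fK]; have mB := @measurable_box R N.
rewrite (_ : EFin \o _ = (EFin \o f) \_ (box N)); last first.
  by apply/funext => t; rewrite /= !patchE; case: ifPn.
have [h _] := @integrable_mkcond _ _ R mu2 (box N) (EFin \o f) mB.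
by apply: h; apply: fK; exact: compact_rect.
Qed.

(** Truncation to the box makes [f] and [w] integrable on the whole plane and is invisible to test
    functions that vanish off the box. *)
Lemma weak_partial_tensor (j : bool) (f w : R * R -> R) (N : R) (alpha beta : R -> R) :
  Defs.locally_integrable f -> Defs.locally_integrable w -> is_weak_partial j f w ->
  smooth1 alpha -> smooth1 beta ->
  (forall z, ~ box N z -> tensor alpha beta z = 0) ->
  let d := if j then tensor alpha (derive1 beta) else tensor (derive1 alpha) beta in
  [/\ mu2.-integrable setT (EFin \o (fun z => (f \_ (box N)) z * d z)),
      mu2.-integrable setT (EFin \o (fun z => (w \_ (box N)) z * tensor alpha beta z)) &
      \int[mu2]_z ((f \_ (box N)) z * d z + (w \_ (box N)) z * tensor alpha beta z) = 0].
Proof.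
move=> lf lw fw sa sb ab0 d.
have st := smooth_tensor sa sb.
have dE : d = partial j (tensor alpha beta) by rewrite (partial_tensor j sa sb).
have sd : smooth d by rewrite dE; exact: (@smooth_partial R _ j st).
have d0 z : ~ box N z -> d z = 0 by rewrite dE; exact: partial_box_eq0.
have [C1 bC1] := continuous_box_bounded (smooth_continuous sd) d0.
have [C2 bC2] := continuous_box_bounded (smooth_continuous st) ab0.
have i1 := integrableMr_bounded (restrict_box_integrable N lf)
  (continuous_measurable2 (smooth_continuous sd)) bC1.
have i2 := integrableMr_bounded (restrict_box_integrable N lw)
  (continuous_measurable2 (smooth_continuous st)) bC2.
split => //; rewrite (RintegralD measurableT i1 i2).
have tt : test_function (tensor alpha beta).
  by apply/test_functionP; split; [exact: st|exists N].
have E (u k : R * R -> R) : (forall z, ~ box N z -> k z = 0) ->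
    \int[mu2]_z ((u \_ (box N)) z * k z) = \int[mu2]_z (u z * k z).
  move=> k0; apply: eq_Rintegral => z _; rewrite patchE; case: ifPn => // /negP nz.
  by rewrite k0 ?mulr0// => zN; apply: nz; rewrite inE.
by rewrite E// E// dE (fw _ tt) addNr.
Qed.

Lemma tensor_weak_vertical (f w : R * R -> R) (N c d : R) :
  Defs.locally_integrable f -> Defs.locally_integrable w -> is_weak_partial true f w ->
  - N <= c -> d <= N -> tensor_weak (f \_ (box N)) (w \_ (box N)) N c d.
Proof.
move=> lf lw fw Nc dN alpha beta sa sb a0 b0.
have [|_ _ <-//] := @weak_partial_tensor true f w N alpha beta lf lw fw sa sb.
move=> z nz; rewrite /tensor.
have [z1|/a0 -> ] := boolP (- N < z.1 < N); last by rewrite mul0r.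
have [z2|/b0 -> ] := boolP (c < z.2 < d); last by rewrite mulr0.
exfalso; apply: nz; move: z1 z2 => /andP[z1 z2] /andP[z3 z4].
by split; rewrite /= in_itv/= !ltW// ?(le_lt_trans Nc z3) ?(lt_le_trans z4 dN).
Qed.

Lemma tensor_weak_horizontal (f w : R * R -> R) (N c d : R) :
  Defs.locally_integrable f -> Defs.locally_integrable w -> is_weak_partial false f w ->
  - N <= c -> d <= N ->
  tensor_weak ((f \_ (box N)) \o @flip R) ((w \_ (box N)) \o @flip R) N c d.
Proof.
move=> lf lw fw Nc dN alpha beta sa sb a0 b0.
(* Flipping exchanges the variables, so [alpha] and [beta] swap places. *)
have [|i1 i2 <-] := @weak_partial_tensor false f w N beta alpha lf lw fw sb sa.
  move=> z nz; rewrite /tensor.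
  have [z1|/a0 -> ] := boolP (- N < z.2 < N); last by rewrite mulr0.
  have [z2|/b0 -> ] := boolP (c < z.1 < d); last by rewrite mul0r.
  exfalso; apply: nz; move: z1 z2 => /andP[z1 z2] /andP[z3 z4].
  by split; rewrite /= in_itv/= !ltW// ?(le_lt_trans Nc z3) ?(lt_le_trans z4 dN).
have [_ <-] := Rintegral_flip (integrableD measurableT i1 i2).
by apply: eq_Rintegral => z _; rewrite /tensor /flip /=; ring.
Qed.

End tensor_weak_gradient.

(** * Continuity *)

Section good_rectangles.
Context {R : realType}.
Notation mu := (@lebesgue_measure R).
Notation mu2 := (@lebesgue2 R).
Notation P2 := (measurableTypeR R * measurableTypeR R)%type.
Notation T1 := (measurableTypeR R).

Lemma ae2_slices (P : P2 -> Prop) : {ae mu2, forall z, P z} ->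
  {ae mu, forall x, {ae mu, forall y, P (x, y)}}.
Proof.
move=> [B [mB B0 PB]].
have := xsection_ae mB B0; apply: (@aeS _ _ _ mu) => x Bx.
exists (xsection B x); split => //; first exact: measurable_xsection.
by move=> y /= nP; rewrite /xsection/= inE; exact: PB.
Qed.

Lemma ae2_flip (P : P2 -> Prop) : {ae mu2, forall z, P z} ->
  {ae mu2, forall z, P (flip z)}.
Proof.
move=> [B [mB B0 PB]]; exists (@flip R @^-1` B); split.
- by rewrite -[X in measurable X]setTI; exact: (@measurable_flip R).
- by rewrite -B0; exact: (lebesgue2_flip mB).
- by move=> z /= nP; exact: PB.
Qed.

(** Chebyshev: a function of average at most e cannot exceed 2e almost everywhere. *)
Lemma pick_good (W : T1 -> R) (P : R -> Prop) (a b e : R) : a < b -> 0 < e ->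
  mu.-integrable setT (EFin \o W) ->
  \int[mu]_(x in `]a, b[) W x <= e * (b - a) -> {ae mu, forall x, P x} ->
  exists x : R, [/\ a < x < b, P x & W x <= 2 * e].
Proof.
move=> ab e0 iW leW aP; apply: contrapT => nex.
pose J : set T1 := `]a, b[%classic.
have mJ : measurable J by exact: measurable_itv.
have muJ : mu J = (b - a)%:E := lebesgue_measure_oo ab.
have finJ : (mu J < +oo)%E by rewrite muJ ltry.
have iJ : mu.-integrable J (EFin \o cst (2 * e)).
  apply: measurable_bounded_integrable => //; exact: bounded_cst.
have : \int[mu]_(x in J) (cst (2 * e)) x <= \int[mu]_(x in J) W x.
  apply: ae_le_Rintegral => //; first exact: integrableS iW.
  move: aP; apply: (@aeS _ _ _ mu) => x Px; rewrite /J/= in_itv/= => xab.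
  by rewrite leNgt; apply/negP => lt; apply: nex; exists x; split => //; exact: ltW.
rewrite Rintegral_cst// => /le_trans/(_ leW).
rewrite [fine _](congr1 (@fine R) muJ)/= ler_pM2r ?subr_gt0//.
by clear - e0; lra.
Qed.

Lemma flip_rect (E : set P2) a b c d : measurable E ->
  mu2 ((@flip R @^-1` E) `&` rect a b c d) = mu2 (E `&` rect c d a b).
Proof.
move=> mE; rewrite -(lebesgue2_flip (_ : measurable (E `&` rect c d a b))); last first.
  by apply: measurableI => //; exact: measurable_rect.
congr (mu2 _); apply/seteqP; split => -[x y] /=; rewrite /flip/=.
  by move=> [? [? ?]]; split.
by move=> [? [? ?]]; split.
Qed.

(** Each point of the rim is within [h] of a side. The strips run over fixed ranges larger than the
    sides, because the good lines in one direction are chosen before the ends of their sides are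
    known. *)
Lemma rim_strips (E : set P2) (a1 a2 b1 b2 c1 c2 d1 d2 h : R) : measurable E ->
  0 < h -> c1 <= a1 -> a2 <= c2 -> d1 <= b1 -> b2 <= d2 ->
  (mu2 (E `&` rim a1 a2 b1 b2 h) <=
    mu2 (E `&` rect (a1 - h) (a1 + h) d1 d2) + mu2 (E `&` rect (a2 - h) (a2 + h) d1 d2) +
   (mu2 (E `&` rect c1 c2 (b1 - h) (b1 + h)) + mu2 (E `&` rect c1 c2 (b2 - h) (b2 + h))))%E.
Proof.
move=> mE h0 ca1 ca2 db1 db2.
have mER a b c d : @measurable _ P2 (E `&` rect a b c d).
  by apply: measurableI => //; exact: measurable_rect.
have mU (A B : set P2) : measurable A -> measurable B -> measurable (A `|` B).
  by move=> mA mB; exact: measurableU.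
set A1 := E `&` rect (a1 - h) _ _ _; set A2 := E `&` rect (a2 - h) _ _ _.
set B1 := E `&` rect _ _ (b1 - h) _; set B2 := E `&` rect _ _ (b2 - h) _.
have mA := mU _ _ (mER _ _ _ _ : measurable A1) (mER _ _ _ _ : measurable A2).
have mB := mU _ _ (mER _ _ _ _ : measurable B1) (mER _ _ _ _ : measurable B2).
have mAB := mU _ _ mA mB.
have mEr : @measurable _ P2 (E `&` rim a1 a2 b1 b2 h).
  by apply: measurableI => //; exact: measurable_rim.
apply: le_trans (_ : _ <= mu2 ((A1 `|` A2) `|` (B1 `|` B2)))%E _; last first.
  apply: le_trans (measureU2 mu2 mA mB) _.
  by apply: leeD; apply: measureU2; exact: mER.
rewrite le_measure ?inE//.
move=> [x y] [Exy [[/= + +] nin]]; rewrite !in_itv/= => /andP[x1 x2] /andP[y1 y2].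
have [xa1|xa1] := ltP x (a1 + h).
  left; left; split => //; split; rewrite /= in_itv/=; apply/andP; split;
    clear - xa1 x1 x2 y1 y2 h0 db1 db2; lra.
have [xa2|xa2] := ltP (a2 - h) x.
  left; right; split => //; split; rewrite /= in_itv/=; apply/andP; split;
    clear - xa2 x1 x2 y1 y2 h0 db1 db2; lra.
have [yb1|yb1] := ltP y (b1 + h).
  right; left; split => //; split; rewrite /= in_itv/=; apply/andP; split;
    clear - yb1 x1 x2 y1 y2 h0 ca1 ca2; lra.
have [yb2|yb2] := ltP (b2 - h) y.
  right; right; split => //; split; rewrite /= in_itv/=; apply/andP; split;
    clear - yb2 x1 x2 y1 y2 h0 ca1 ca2; lra.
by exfalso; apply: nin; split; rewrite /= in_itv/= ?xa1 ?xa2 ?yb1 ?yb2.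
Qed.

(* [A1] and [A2] are the averages of [f] on horizontal and vertical lines. Each
   chosen side deviates from its average by at most [2e]; passing from one side
   to another through their crossing point costs [4e]. *)
Lemma good_rect (f : P2 -> R) (A1 A2 W1 W2 : R -> R) (M e p q r : R)
    (E : nat -> set P2) : 0 < r -> 0 < e -> (forall j, measurable (E j)) ->
  mu.-integrable setT (EFin \o W1) -> mu.-integrable setT (EFin \o W2) ->
  \int[mu]_(x in `]p - 2 * r, p - r[) W2 x <= e * r ->
  \int[mu]_(x in `]p + r, p + 2 * r[) W2 x <= e * r ->
  \int[mu]_(x in `]q - 2 * r, q - r[) W1 x <= e * r ->
  \int[mu]_(x in `]q + r, q + 2 * r[) W1 x <= e * r ->
  {ae mu2, forall z, p - 3 * r < z.1 < p + 3 * r -> q - 3 * r < z.2 < q + 3 * r ->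
    [/\ `|f z - A2 z.1| <= W2 z.1, `|f z - A1 z.2| <= W1 z.2 & `|f z| <= M]} ->
  exists a1 a2 b1 b2 c : R,
    [/\ p - 2 * r < a1 < p - r /\ p + r < a2 < p + 2 * r,
        q - 2 * r < b1 < q - r /\ q + r < b2 < q + 2 * r, `|c| <= M &
        forall j, (forall z, E j z -> 8 * e < `|f z - c|) ->
        forall e', 0 < e' -> exists2 h, 0 < h <= 1 &
          (mu2 (E j `&` rim a1 a2 b1 b2 h) <= (e' * h)%:E)%E].
Proof.
move=> r0 e0 mE iW1 iW2 pl pr ql qr good.
have mfE j : @measurable _ P2 (@flip R @^-1` E j).
  by rewrite -[X in measurable X]setTI; exact: (@measurable_flip R).
pose G (x y : R) := p - 3 * r < x < p + 3 * r -> q - 3 * r < y < q + 3 * r ->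
    [/\ `|f (x, y) - A2 x| <= W2 x, `|f (x, y) - A1 y| <= W1 y & `|f (x, y)| <= M].
have aeGx : {ae mu, forall x : R, {ae mu, forall y : R, G x y}}.
  exact: (ae2_slices good).
have aeGy : {ae mu, forall y : R, {ae mu, forall x : R, G x y}}.
  exact: (ae2_slices (ae2_flip good)).
(* One null set serves all [E j], so lines can be chosen although it depends on the later [c] which
   slices are null. *)
have aeSx := @ae_foralln _ _ _ mu _ (fun j => null_section_strip (q - 2 * r) (q + 2 * r) (mE j)).
have aeSy := @ae_foralln _ _ _ mu _ (fun j => null_section_strip (p - 2 * r) (p + 2 * r) (mfE j)).
have aeX := @aeI _ _ _ mu _ _ aeGx aeSx.
have E1 (s t : R) : s - t - (s - 2 * t) = t by ring.
have E2 (s t : R) : s + 2 * t - (s + t) = t by ring.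
have lt1 (s : R) : s - 2 * r < s - r by clear - r0; lra.
have lt2 (s : R) : s + r < s + 2 * r by clear - r0; lra.
rewrite -[in X in _ <= X](E1 p r) in pl; rewrite -[in X in _ <= X](E2 p r) in pr.
rewrite -[in X in _ <= X](E1 q r) in ql; rewrite -[in X in _ <= X](E2 q r) in qr.
have [a1 [/andP[a1l a1r] [Ga1 Sa1] Wa1]] := pick_good (lt1 p) e0 iW2 pl aeX.
have [a2 [/andP[a2l a2r] [Ga2 Sa2] Wa2]] := pick_good (lt2 p) e0 iW2 pr aeX.
(* The horizontal sides are chosen after the vertical ones, so that the corners can be required to
   be good points too. *)
have aeY := @aeI _ _ _ mu _ _ (@aeI _ _ _ mu _ _ aeGy aeSy) (@aeI _ _ _ mu _ _ Ga1 Ga2).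
have [b1 [/andP[b1l b1r] [[Gb1 Sb1] [Ga1b1 Ga2b1]] Wb1]] :=
  pick_good (lt1 q) e0 iW1 ql aeY.
have [b2 [/andP[b2l b2r] [[Gb2 Sb2] [Ga1b2 Ga2b2]] Wb2]] :=
  pick_good (lt2 q) e0 iW1 qr aeY.
have a1K : p - 3 * r < a1 < p + 3 * r by apply/andP; split; clear - a1l a1r r0; lra.
have a2K : p - 3 * r < a2 < p + 3 * r by apply/andP; split; clear - a2l a2r r0; lra.
have b1K : q - 3 * r < b1 < q + 3 * r by apply/andP; split; clear - b1l b1r r0; lra.
have b2K : q - 3 * r < b2 < q + 3 * r by apply/andP; split; clear - b2l b2r r0; lra.
(* Three corners suffice: the first provides [c], the others link [A1 b2] and [A2 a2] to it. *)
have [u11 v11 m11] := Ga1b1 a1K b1K.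
have [u12 v12 _] := Ga1b2 a1K b2K.
have [u21 v21 _] := Ga2b1 a2K b1K.
exists a1, a2, b1, b2, (f (a1, b1)); split => //; try by rewrite ?a1l ?a2l ?b1l ?b2l.
set c := f (a1, b1) in u11 v11 m11 *.
have cA2a1 : `|A2 a1 - c| <= 2 * e by rewrite distrC; exact: le_trans Wa1.
have cA1b1 : `|A1 b1 - c| <= 2 * e by rewrite distrC; exact: le_trans Wb1.
have link (s A B t W W' : R) : `|s - A| <= W -> W <= 2 * e -> `|s - B| <= W' ->
    W' <= 2 * e -> `|B - t| <= 2 * e -> `|A - t| <= 6 * e.
  clear; rewrite !ler_norml => /andP[? ?] ? /andP[? ?] ? /andP[? ?].
  by apply/andP; split; lra.
have cA2a2 : `|A2 a2 - c| <= 6 * e := link _ _ _ _ _ _ u21 Wa2 v21 Wb1 cA1b1.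
have cA1b2 : `|A1 b2 - c| <= 6 * e := link _ _ _ _ _ _ v12 Wb2 u12 Wa1 cA2a1.
have le26 (s : R) : s <= 2 * e -> s <= 6 * e by clear - e0; lra.
move=> j Ej e' e'0.
have sec (A W s : R) : `|s - A| <= W -> W <= 2 * e -> `|A - c| <= 6 * e ->
    `|s - c| <= 8 * e.
  move: c {u11 v11 m11 cA2a1 cA1b1 cA2a2 cA1b2 Ej} => c; clear.
  rewrite !ler_norml => /andP[? ?] ? /andP[? ?].
  by apply/andP; split; lra.
have nullset (S : set T1) : measurable S -> {ae mu, forall y, ~ S y} -> mu S = 0%E.
  move=> mS [B [mB B0 SB]]; apply/eqP; rewrite -measure_le0 -B0 le_measure ?inE//.
  by move=> y Sy; apply: SB => /= /(_ Sy).
have mJ (s t : R) : @measurable _ T1 `[s, t]%classic by exact: measurable_itv.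
have sub3 (s y : R) : s - 2 * r <= y <= s + 2 * r -> s - 3 * r < y < s + 3 * r.
  by clear - r0; move=> /andP[? ?]; apply/andP; split; lra.
have nullx (a : R) : `|A2 a - c| <= 6 * e -> W2 a <= 2 * e ->
    p - 3 * r < a < p + 3 * r -> {ae mu, forall y, G a y} ->
    mu (xsection (E j) a `&` `[q - 2 * r, q + 2 * r]) = 0%E.
  move=> Ac Wa aK aG; apply: nullset.
    by apply: measurableI => //; exact: measurable_xsection.
  move: aG; apply: (@aeS _ _ _ mu) => y Gay [].
  rewrite /xsection/= inE in_itv/= => Eay /sub3 yK.
  have [h1 _ _] := Gay aK yK.
  by have := Ej _ Eay; rewrite ltNge (sec _ _ _ h1 Wa Ac).
have nully (b : R) : `|A1 b - c| <= 6 * e -> W1 b <= 2 * e ->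
    q - 3 * r < b < q + 3 * r -> {ae mu, forall x, G x b} ->
    mu (xsection (@flip R @^-1` E j) b `&` `[p - 2 * r, p + 2 * r]) = 0%E.
  move=> Ac Wb bK bG; apply: nullset.
    by apply: measurableI => //; exact: (measurable_xsection _ (mfE j)).
  move: bG; apply: (@aeS _ _ _ mu) => x Gxb [].
  rewrite /xsection/= inE in_itv/= => Exb /sub3 xK.
  have [_ h1 _] := Gxb xK bK.
  by have := Ej _ Exb; rewrite ltNge (sec _ _ _ h1 Wb Ac).
have e4 : 0 < e' / 4 by rewrite divr_gt0.
have [k1 k10 H1] := Sa1 j (nullx a1 (le26 _ cA2a1) Wa1 a1K Ga1) _ e4.
have [k2 k20 H2] := Sa2 j (nullx a2 cA2a2 Wa2 a2K Ga2) _ e4.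
have [k3 k30 H3] := Sb1 j (nully b1 (le26 _ cA1b1) Wb1 b1K Gb1) _ e4.
have [k4 k40 H4] := Sb2 j (nully b2 cA1b2 Wb2 b2K Gb2) _ e4.
have [h [h0 h1 hk1 hk2 [hk3 hk4]]] : exists h : R,
    [/\ 0 < h, h <= 1, h < k1, h < k2 & h < k3 /\ h < k4].
  pose m := Num.min (Num.min 1 k1) (Num.min k2 (Num.min k3 k4)).
  have m0 : 0 < m by rewrite !lt_min ltr01 k10 k20 k30 k40.
  have : m / 2 < m by clear - m0; lra.
  rewrite /m !lt_min -/m => /andP[/andP[l1 l2] /andP[l3 /andP[l4 l5]]].
  by exists (m / 2); split; rewrite ?divr_gt0// ltW.
exists h; first by rewrite h0.
apply: le_trans (rim_strips (mE j) h0 (ltW a1l) (ltW a2r) (ltW b1l) (ltW b2r)) _.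
have -> : (e' * h)%:E =
    ((e' / 4 * h)%:E + (e' / 4 * h)%:E + ((e' / 4 * h)%:E + (e' / 4 * h)%:E))%E.
  by rewrite -!EFinD; congr EFin; clear; field.
have {}H3 := H3 h; have {}H4 := H4 h.
rewrite !(flip_rect _ _ _ _ (mE j)) in H3 H4.
apply: leeD; apply: leeD.
- by apply: H1; rewrite h0.
- by apply: H2; rewrite h0.
- by apply: H3; rewrite h0.
- by apply: H4; rewrite h0.
Qed.

End good_rectangles.

(** * Smallness of the integral of the gradient *)

Section small_gradient.
Context {R : realType}.
Notation mu := (@lebesgue_measure R).
Notation mu2 := (@lebesgue2 R).
Notation P2 := (measurableTypeR R * measurableTypeR R)%type.
Notation T1 := (measurableTypeR R).

Definition square (z : R * R) (r : R) : set (R * R) :=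
  rect (z.1 - r) (z.1 + r) (z.2 - r) (z.2 + r).

(** The square has area 36 r^2, and by absolute continuity the integral of u^2 over it falls below
    e^2/144. Cauchy-Schwarz, in its arithmetic-geometric mean form, then gives two terms of e
    r/2. *)
Lemma small_gradient (u : P2 -> R) (z : R * R) (e : R) :
  mu2.-integrable setT (EFin \o u) ->
  mu2.-integrable setT (EFin \o (fun z => u z ^+ 2)) -> 0 < e ->
  exists2 rho, 0 < rho & forall r, 0 < r < rho ->
    \int[mu2]_(y in square z (3 * r)) `|u y| <= e * r.
Proof.
move=> ui u2 e0.
have e2 : 0 < e ^+ 2 / 144 by rewrite divr_gt0// exprn_gt0.
have [dl [dl0 Hdl]] := integral_normr_continuous u2 e2.
(* For r < 1 the area 36 r^2 is at most 36 r, hence below [dl]. *)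
exists (Num.min 1 (dl / 36)) => [|r /andP[r0]]; first by rewrite lt_min ltr01 divr_gt0.
rewrite lt_min => /andP[r1 rdl].
set Q := square z (3 * r).
have mQ : @measurable _ P2 Q by exact: measurable_rect.
have muQ : mu2 Q = (36 * r ^+ 2)%:E.
  rewrite /Q /square lebesgue2_rect; [|by clear - r0; lra..].
  by congr EFin; clear; ring.
have finQ : (mu2 Q < +oo)%E by rewrite muQ ltry.
have iu : mu2.-integrable Q (EFin \o u) by exact: integrableS ui.
have iu2 : mu2.-integrable Q (EFin \o (fun z => u z ^+ 2)) by exact: integrableS u2.
have small : \int[mu2]_(y in Q) (u y ^+ 2) < e ^+ 2 / 144.
  have : (mu2 Q < dl%:E)%E.
    rewrite muQ lte_fin expr2; have : 36 * (r * r) <= 36 * r.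
      by rewrite ler_pM2l// ler_piMl// ltW.
    by move/le_lt_trans; apply; rewrite mulrC -ltr_pdivlMr.
  move=> /(Hdl Q mQ); apply: le_lt_trans.
  by apply: le_Rintegral => //; [exact: (integrable_norm iu2)|move=> y _; exact: ler_norm].
(* [|u| <= 1/k + k u^2], with [k] balancing the two integrals. *)
pose k := 72 * r / e.
have k0 : 0 < k by rewrite divr_gt0// mulr_gt0.
have ic : mu2.-integrable Q (EFin \o cst (k^-1)).
  by apply: measurable_bounded_integrable => //; exact: bounded_cst.
have ik : mu2.-integrable Q (EFin \o (fun y => k * u y ^+ 2)).
  exact: (integrableZl mQ k iu2).
apply: le_trans (_ : \int[mu2]_(y in Q) (cst k^-1 y + k * u y ^+ 2) <= _).
  apply: le_Rintegral => //; [exact: (integrable_norm iu)|exact: (integrableD mQ ic ik)|].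
  move=> y _ /=; set v := u y.
  have h : 0 <= (k * `|v| - 1) ^+ 2 by exact: sqr_ge0.
  have v2 : v ^+ 2 = `|v| ^+ 2 by rewrite real_normK// num_real.
  rewrite v2 -(ler_pM2l k0) mulrDr divff ?gt_eqF//.
  have := normr_ge0 v; move: (`|v|) h => s h s0.
  have : 0 <= k * s by rewrite mulr_ge0// ltW.
  by clear - h; rewrite -[k * (k * s ^+ 2)]/(_); nra.
rewrite (RintegralD mQ ic ik) Rintegral_cst// (RintegralZl k mQ iu2).
rewrite [fine _](congr1 (@fine R) muQ)/=.
have -> : k^-1 * (36 * r ^+ 2) = e * r / 2.
  by rewrite /k; field; rewrite !gt_eqF.
apply: le_trans (_ : e * r / 2 + k * (e ^+ 2 / 144) <= _).
  by rewrite lerD2l ler_pM2l// ltW.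
have -> : k * (e ^+ 2 / 144) = e * r / 2.
  by rewrite /k; field; rewrite !gt_eqF.
by rewrite -splitr.
Qed.

End small_gradient.

Section gradient_good_rect.
Context {R : realType}.
Notation mu := (@lebesgue_measure R).
Notation mu2 := (@lebesgue2 R).
Notation P2 := (measurableTypeR R * measurableTypeR R)%type.
Notation T1 := (measurableTypeR R).

Lemma restrict_box_sqr_integrable (u : R * R -> R) N :
  mu2.-integrable setT (EFin \o (fun z => u z ^+ 2)) ->
  mu2.-integrable setT (EFin \o (fun z => (u \_ (box N)) z ^+ 2)).
Proof.
move=> u2; have mB := @measurable_box R N.
rewrite (_ : EFin \o _ = (EFin \o (fun z => u z ^+ 2)) \_ (box N)); last first.
  by apply/funext => t; rewrite /= !patchE; case: ifPn => //; rewrite expr0n.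
have [h _] := @integrable_mkcond _ _ R mu2 (box N) (EFin \o (fun z => u z ^+ 2)) mB.
by apply: h; exact: integrableS u2.
Qed.

Lemma slab_le (w : P2 -> R) (z : R * R) (a b r e : R) : 0 < r ->
  mu2.-integrable setT (EFin \o w) ->
  \int[mu2]_(y in square z (3 * r)) `|w y| <= e ->
  z.1 - 3 * r <= a -> b <= z.1 + 3 * r ->
  \int[mu]_(x in `]a, b[) \int[mu]_(y in `[z.2 - 3 * r, z.2 + 3 * r]) `|w (x, y)| <= e.
Proof.
move=> r0 iw we za bz.
have iaw := integrable_norm iw.
have [_ ->] := @slice_integral_on R (fun z => `|w z|) `]a, b[%classic
  `[z.2 - 3 * r, z.2 + 3 * r]%classic (measurable_itv _) (measurable_itv _) iaw.
set S := _ `*` _.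
have mS : @measurable _ P2 S by apply: measurableX; exact: measurable_itv.
have mQ : @measurable _ P2 (square z (3 * r)) by exact: measurable_rect.
apply: le_trans we; rewrite /Rintegral fine_le//.
- exact: (integrable_fin_num mS (integrableS measurableT mS (@subsetT _ _) iaw)).
- exact: (integrable_fin_num mQ (integrableS measurableT mQ (@subsetT _ _) iaw)).
apply: ge0_subset_integral => //.
- by apply: measurable_funTS; case/integrableP : iaw.
move=> [x y] [/= + +]; rewrite !in_itv/= => /andP[xa xb] yz; split => /=.
  by rewrite in_itv/=; apply/andP; split; clear - xa xb za bz; lra.
by rewrite in_itv.
Qed.

Lemma gradient_good_rect (f u0 u1 : R * R -> R) (M e : R) (z0 : R * R) :
  Defs.locally_integrable f -> Defs.locally_integrable u0 ->
  Defs.locally_integrable u1 -> is_weak_partial false f u0 -> is_weak_partial true f u1 ->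
  mu2.-integrable setT (EFin \o (fun z => u0 z ^+ 2)) ->
  mu2.-integrable setT (EFin \o (fun z => u1 z ^+ 2)) ->
  {ae mu2, forall z, `|f z| <= M} -> 0 < e ->
  exists2 rho, 0 < rho & forall r, 0 < r < rho -> forall E : nat -> set P2,
    (forall j, measurable (E j)) ->
    exists a1 a2 b1 b2 c : R,
    [/\ z0.1 - 2 * r < a1 < z0.1 - r /\ z0.1 + r < a2 < z0.1 + 2 * r,
        z0.2 - 2 * r < b1 < z0.2 - r /\ z0.2 + r < b2 < z0.2 + 2 * r, `|c| <= M &
        forall j, (forall z, E j z -> 8 * e < `|f z - c|) ->
        forall e', 0 < e' -> exists2 h, 0 < h <= 1 &
          (mu2 (E j `&` rim a1 a2 b1 b2 h) <= (e' * h)%:E)%E].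
Proof.
case: z0 => p q /= lf l0 l1 f0 f1 s0 s1 fM e0.
(* The box contains the square of half-side 3r around (p, q) for every r < 1. *)
pose N := `|p| + `|q| + 3.
pose g := f \_ (box N).
pose w0 := (u0 \_ (box N)) \o @flip R.
pose w1 := u1 \_ (box N).
have ig : mu2.-integrable setT (EFin \o g) := restrict_box_integrable N lf.
have [igf _] := Rintegral_flip ig.
have [iw0 _] := Rintegral_flip (restrict_box_integrable N l0).
have iw1 : mu2.-integrable setT (EFin \o w1) := restrict_box_integrable N l1.
have [iw0s _] := Rintegral_flip (restrict_box_sqr_integrable N s0).
have iw1s := restrict_box_sqr_integrable N s1.
have [r0 r00 H0] := small_gradient (q, p) iw0 iw0s e0.
have [r1 r10 H1] := small_gradient (p, q) iw1 iw1s e0.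
exists (Num.min 1 (Num.min r0 r1)) => [|r]; first by rewrite !lt_min ltr01 r00 r10.
rewrite !lt_min => /andP[rgt0 /andP[rlt1 /andP[rr0 rr1]]] E mE.
have {}H0 := H0 r; have {}H1 := H1 r; rewrite rgt0 rr0 in H0; rewrite rgt0 rr1 in H1.
have {}H0 := H0 isT; have {}H1 := H1 isT.
have boxN (s t : R) : `|s| + `|t| + 3 <= N -> [/\ - N <= s - 3 * r, s + 3 * r <= N & 3 * r <= 3].
  move=> sN; have a1 := ler_norm s; have a2 := ler_norm (- s); rewrite normrN in a2.
  have a3 := normr_ge0 t.
  by split; clear - sN a1 a2 a3 rlt1; lra.
have [pN1 pN2 _] := boxN p q (lexx _).
have [qN1 qN2 _] : [/\ - N <= q - 3 * r, q + 3 * r <= N & 3 * r <= 3].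
  by apply: (boxN q p); rewrite /N [`|q| + _]addrC.
have ltp : p - 3 * r < p + 3 * r by clear - rgt0; lra.
have ltq : q - 3 * r < q + 3 * r by clear - rgt0; lra.
have [B2 [mB2 B20 HB2]] := slice_average_dev ltq ig iw1
  (tensor_weak_vertical lf l1 f1 qN1 qN2).
have [B1 [mB1 B10 HB1]] := slice_average_dev ltp igf iw0
  (tensor_weak_horizontal lf l0 f0 pN1 pN2).
pose A2 x := (q + 3 * r - (q - 3 * r))^-1 *
  \int[mu]_(t in `](q - 3 * r), (q + 3 * r)[) g (x, t).
pose W2 x := \int[mu]_(t in `[(q - 3 * r), (q + 3 * r)]) `|w1 (x, t)|.
pose A1 x := (p + 3 * r - (p - 3 * r))^-1 *
  \int[mu]_(t in `](p - 3 * r), (p + 3 * r)[) (g \o @flip R) (x, t).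
pose W1 x := \int[mu]_(t in `[(p - 3 * r), (p + 3 * r)]) `|w0 (x, t)|.
have [iW2 _] := @slice_integral_on R (fun z => `|w1 z|) setT
  `[q - 3 * r, q + 3 * r]%classic measurableT (measurable_itv _) (integrable_norm iw1).
have [iW1 _] := @slice_integral_on R (fun z => `|w0 z|) setT
  `[p - 3 * r, p + 3 * r]%classic measurableT (measurable_itv _) (integrable_norm iw0).
apply: (@good_rect R f A1 A2 W1 W2 M e p q r E) => //.
- by apply: (@slab_le w1 (p, q) _ _ r) => //=; clear - rgt0; lra.
- by apply: (@slab_le w1 (p, q) _ _ r) => //=; clear - rgt0; lra.
- by apply: (@slab_le w0 (q, p) _ _ r) => //=; clear - rgt0; lra.
- by apply: (@slab_le w0 (q, p) _ _ r) => //=; clear - rgt0; lra.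
have ae2 : {ae mu2, forall z, ~ B2 z}.
  by exists B2; split => // z /= /contrapT.
have ae1 : {ae mu2, forall z, ~ B1 (flip z)}.
  apply: (@ae2_flip R (fun z => ~ B1 z)).
  by exists B1; split => // z /= /contrapT.
have := @aeI _ _ _ mu2 _ _ (@aeI _ _ _ mu2 _ _ ae1 ae2) fM.
apply: (@aeS _ _ _ mu2) => z [[nB1 nB2] fz] zp zq.
have z1N : - N < z.1 < N.
  move: zp => /andP[h1 h2]; apply/andP; split; first exact: le_lt_trans pN1 h1.
  exact: lt_le_trans h2 pN2.
have z2N : - N < z.2 < N.
  move: zq => /andP[h1 h2]; apply/andP; split; first exact: le_lt_trans qN1 h1.
  exact: lt_le_trans h2 qN2.
have gz : g z = f z.
  rewrite /g patchE ifT// inE; move: z1N z2N => /andP[? ?] /andP[? ?].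
  by split; rewrite /= in_itv/= !ltW.
split => //.
- by rewrite -gz; exact: (HB2 z nB2 z1N zq).
- have := HB1 (flip z) nB1 z2N zp.
  by rewrite /= [flip (flip z)](_ : _ = z) ?gz//; case: (z).
Qed.
End gradient_good_rect.

(** * Essential oscillation at small scale *)

Section local_oscillation.
Context {R : realType}.
Notation mu := (@lebesgue_measure R).
Notation mu2 := (@lebesgue2 R).
Notation P2 := (measurableTypeR R * measurableTypeR R)%type.
Notation T1 := (measurableTypeR R).

Lemma eventually_below (P : nat -> R -> Prop) :
  (forall k, exists2 rho, 0 < rho & forall r, 0 < r < rho -> P k r) ->
  forall K, exists2 rho, 0 < rho & forall k r, (k < K)%N -> 0 < r < rho -> P k r.
Proof.
move=> HP; elim=> [|K [rho rho0 IH]]; first by exists 1.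
have [rho1 rho10 H1] := HP K.
exists (Num.min rho rho1) => [|k r]; first by rewrite lt_min rho0.
rewrite ltnS leq_eqVlt lt_min => /orP[/eqP ->|kK] /andP[r0 /andP[r1 r2]].
  by apply: H1; rewrite r0.
by apply: IH => //; rewrite r0.
Qed.

Lemma grid_point (L d s : R) : 0 < d -> L <= s ->
  exists j : nat, s < L + j%:R * d <= s + d.
Proof.
move=> d0 Ls.
have /Num.Theory.truncn_itv : 0 <= (s - L) / d by rewrite divr_ge0 ?subr_ge0// ltW.
set m := Num.truncn _ => /andP[h1 h2].
exists m.+1; rewrite ltr_pdivrMr// in h2; rewrite ler_pdivlMr// in h1.
have mS : m.+1%:R * d = m%:R * d + d by rewrite -natr1 mulrDl mul1r.
by rewrite mS in h2 *; apply/andP; split; clear - h1 h2; lra.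
Qed.

Lemma outside_small_square (E : set P2) (z : R * R) : measurable E -> mu2 E <> 0%E ->
  exists2 rho, 0 < rho & forall r, 0 < r < rho -> mu2 (E `\` square z (2 * r)) <> 0%E.
Proof.
move=> mE E0.
have [m m0 mE'] : exists2 m : R, 0 < m & (m%:E <= mu2 E)%E.
  have Egt : (0 < mu2 E)%E by rewrite lt0e measure_ge0 andbT; exact/eqP.
  case: (mu2 E) Egt => [s|//|//]; last by exists 1 => //; rewrite leey.
  by rewrite lte_fin => s0; exists s.
(* The square of half-side 2r has area 16 r^2, at most 16 r and so below [m]. *)
exists (Num.min 1 (m / 16)) => [|r /andP[r0]]; first by rewrite lt_min ltr01 divr_gt0.
rewrite lt_min => /andP[r1 rm] out0.
have mQ : @measurable _ P2 (square z (2 * r)) by exact: measurable_rect.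
have : (m%:E <= mu2 (square z (2 * r)))%E.
  apply: le_trans mE' _.
  have mI : @measurable _ P2 (E `&` square z (2 * r)) by exact: measurableI.
  have mD : @measurable _ P2 (E `\` square z (2 * r)) by exact: measurableD.
  have EU := measureU2 mu2 mI mD; rewrite setUIDK in EU.
  apply: le_trans EU _.
  have out_le : (mu2 (E `\` square z (2 * r)) <= 0)%E by rewrite measure_le0; exact/eqP.
  apply: le_trans (leeD2l _ out_le) _; rewrite adde0.
  by rewrite le_measure ?inE//; exact: subIsetr.
rewrite /square lebesgue2_rect; [|by clear - r0; lra..].
rewrite lee_fin leNgt => /negP; apply.
have rr : r * r <= r by rewrite ler_piMl// ltW.
have -> : (z.1 + 2 * r - (z.1 - 2 * r)) * (z.2 + 2 * r - (z.2 - 2 * r)) = 16 * (r * r).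
  by clear; ring.
by clear - rm rr; lra.
Qed.

(** One admissible level is taken in each cell of a grid of mesh e/4, before [r] and [c] exist.
    Whatever [c] in [-M, M] turns out to be, one level lies in ]c + e/2, c + e[ and one in ]c - e, c
    - e/2[, since two consecutive cells fit in a length e/2. *)
Lemma local_oscillation (f u0 u1 : R * R -> R) (M e : R) (z0 : R * R) :
  Defs.locally_integrable f -> Defs.locally_integrable u0 ->
  Defs.locally_integrable u1 -> is_weak_partial false f u0 -> is_weak_partial true f u1 ->
  mu2.-integrable setT (EFin \o (fun z => u0 z ^+ 2)) ->
  mu2.-integrable setT (EFin \o (fun z => u1 z ^+ 2)) ->
  {ae mu2, forall z, `|f z| <= M} ->
  {ae mu, forall t : R,
    indecomposable [set x | t < f x] /\ indecomposable [set x | f x < t]} ->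
  0 < e ->
  exists r c : R, 0 < r /\ {ae mu2, forall z,
    open_rect (z0.1 - r) (z0.1 + r) (z0.2 - r) (z0.2 + r) z -> `|f z - c| <= e}.
Proof.
move=> lf l0 l1 f0 f1 s0 s1 fM fmon e0.
have d0 : 0 < e / 4 by rewrite divr_gt0.
set d := e / 4 in d0; pose L := - M - e - 1.
have /choice[t Ht] : forall j : nat, exists t : R, [/\ L + j%:R * d < t < L + j.+1%:R * d,
    indecomposable [set x | t < f x] & indecomposable [set x | f x < t]].
  move=> j; pose J : set T1 := `](L + j%:R * d), (L + j.+1%:R * d)[%classic.
  have lt : L + j%:R * d < L + j.+1%:R * d by rewrite ltrD2l ltr_pM2r// ltr_nat.
  have muJ : mu J = (L + j.+1%:R * d - (L + j%:R * d))%:E := lebesgue_measure_oo lt.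
  have J0 : (0 < mu J)%E by rewrite muJ lte_fin subr_gt0.
  have mJ : measurable J by exact: measurable_itv.
  have [s] := @ae_mem _ _ _ mu _ _ mJ J0 fmon.
  by rewrite /J/= in_itv/= => sJ [i1 i2]; exists s; split.
(* Both families share one sequence: index 2j is the superlevel set of [t j], index 2j + 1 its
   sublevel set. *)
pose E (k : nat) : set P2 :=
  if odd k then [set x | f x < t k./2] else [set x | t k./2 < f x].
have iE k : indecomposable (E k).
  by rewrite /E; have [_ i1 i2] := Ht k./2; case: ifP.
have mE k : @measurable _ P2 (E k) by have [mEk _ _] := iE k; exact: mEk.
have out k : exists2 rho, 0 < rho & forall r, 0 < r < rho ->
    mu2 (E k) <> 0%E -> mu2 (E k `\` square z0 (2 * r)) <> 0%E.
  have [Ek0|Ek0] := pselect (mu2 (E k) = 0%E); first by exists 1.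
  have [rho rho0 H] := outside_small_square z0 (mE k) Ek0.
  by exists rho => // r rr _; exact: H.
have e16 : 0 < e / 16 by rewrite divr_gt0.
have [rho1 rho10 good] := gradient_good_rect z0 lf l0 l1 f0 f1 s0 s1 fM e16.
(* [K] exceeds the indices of all sets that any [c] in [-M, M] may call for, so finitely many radii
   have to be minimised. *)
have [K HK] : exists K : nat, forall (j : nat) (s : R), L + j%:R * d <= s + d ->
    s <= M + e -> (j.*2.+1 < K)%N.
  pose m := Num.truncn ((M + e + d - L) / d).
  exists m.+1.*2 => j s js sM.
  suff jm : (j <= m)%N by rewrite -doubleS leq_double ltnS.
  have jx : j%:R <= (M + e + d - L) / d.
    by rewrite ler_pdivlMr//; clear - js sM; lra.
  by rewrite /m Num.Theory.truncn_ge_nat// (le_trans _ jx).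
have [rho2 rho20 outK] := eventually_below out K.
have [r r0 [r1 r2]] : exists2 r : R, 0 < r & r < rho1 /\ r < rho2.
  have m0 : 0 < Num.min rho1 rho2 by rewrite lt_min rho10.
  have : Num.min rho1 rho2 / 2 < Num.min rho1 rho2 by clear - m0; lra.
  by rewrite lt_min => /andP[? ?]; exists (Num.min rho1 rho2 / 2); rewrite ?divr_gt0.
have [|a1 [a2 [b1 [b2 [c]]]]] := good r _ E mE; first by rewrite r0.
move=> [[/andP[a1l a1r] /andP[a2l a2r]] [/andP[b1l b1r] /andP[b2l b2r]] cM thin].
have QS : open_rect a1 a2 b1 b2 `<=` square z0 (2 * r).
  move=> [x y] [/= + +]; rewrite !in_itv/= => /andP[x1 x2] /andP[y1 y2].
  by split; rewrite /= in_itv/=; apply/andP; split; rewrite ltW//;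
    [exact: lt_trans x1|exact: lt_trans a2r|exact: lt_trans y1|exact: lt_trans b2r].
have null k : (k < K)%N -> (forall z, E k z -> 8 * (e / 16) < `|f z - c|) ->
    mu2 (E k `&` open_rect a1 a2 b1 b2) = 0%E.
  move=> kK far; have [//|outQ] := indecomposable_rect (iE k) (thin k far).
  have mQ := @measurable_open_rect R a1 a2 b1 b2.
  have [Ek0|Ek0] := pselect (mu2 (E k) = 0%E).
    apply/eqP; rewrite -measure_le0 -Ek0 le_measure ?inE//; exact: measurableI.
  exfalso; apply: (outK k r kK _ Ek0); first by rewrite r0.
  apply/eqP; rewrite -measure_le0 -outQ le_measure ?inE//.
  - by apply: measurableD => //; exact: measurable_rect.
  - exact: measurableD.
  - by move=> z [Ez nz]; split => // Qz; apply: nz; exact: QS.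
have e8 : 8 * (e / 16) = e / 2 by clear; field.
have cM' : - M <= c <= M by rewrite -ler_norml.
have [j1 /andP[j1l j1r]] : exists j : nat, c + e / 2 < L + j%:R * d <= c + e / 2 + d.
  by apply: grid_point => //; rewrite /L; clear - cM' e0; lra.
have [j2 /andP[j2l j2r]] : exists j : nat, c - e < L + j%:R * d <= c - e + d.
  by apply: grid_point => //; rewrite /L; clear - cM' e0; lra.
have [/andP[t1l t1r] _ _] := Ht j1; have [/andP[t2l t2r] _ _] := Ht j2.
have natS (j : nat) : j.+1%:R * d = j%:R * d + d by rewrite -natr1 mulrDl mul1r.
rewrite natS in t1r; rewrite natS in t2r.
have ed : e = 4 * d by rewrite /d; clear; field.
pose U : set P2 := [set x | t j1 < f x] `&` open_rect a1 a2 b1 b2.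
pose V : set P2 := [set x | f x < t j2] `&` open_rect a1 a2 b1 b2.
have up : mu2 U = 0%E.
  have := null j1.*2; rewrite /E odd_double doubleK; apply.
    apply: leq_trans (HK j1 _ j1r _); first by rewrite ltnS leqnSn.
    by clear - cM' e0; lra.
  move=> z /= fz; rewrite e8; apply: lt_le_trans (ler_norm _).
  by clear - fz t1l j1l; lra.
have lo : mu2 V = 0%E.
  have := null j2.*2.+1; rewrite /E /= odd_double/= uphalf_double; apply.
    by apply: (HK j2 _ j2r); clear - cM' e0; lra.
  move=> z /= fz; rewrite e8 distrC; apply: lt_le_trans (ler_norm _).
  by clear - fz t2r j2r ed d0; lra.
exists r, c; split => //.
have mU : measurable U.
  by apply: measurableI; [have := mE j1.*2; rewrite /E odd_double doubleK|exact: measurable_open_rect].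
have mV : measurable V.
  by apply: measurableI; [have := mE j2.*2.+1; rewrite /E /= odd_double/= uphalf_double|exact: measurable_open_rect].
exists (U `|` V); split.
- exact: measurableU.
- apply/eqP; rewrite -measure_le0; apply: le_trans (measureU2 mu2 mU mV) _.
  have le0 (x : \bar R) : x = 0%E -> (x <= 0)%E by move=> ->.
  by rewrite -[leRHS]adde0; apply: leeD; apply: le0; [exact: up|exact: lo].
move=> z /= nz; apply: contrapT => nB; apply: nz => -[/= + +].
rewrite !in_itv/= => /andP[x1 x2] /andP[y1 y2].
have Qz : open_rect a1 a2 b1 b2 z.
  by split; rewrite /= in_itv/=; apply/andP; split;
   [exact: lt_trans a1r x1|exact: lt_trans x2 a2l|exact: lt_trans b1r y1|exact: lt_trans y2 b2l].
have fu : f z <= t j1.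
  by rewrite leNgt; apply/negP => lt; apply: nB; left.
have fl : t j2 <= f z.
  by rewrite leNgt; apply/negP => lt; apply: nB; right.
rewrite ler_norml; apply/andP; split; clear - fu fl t1r t1l t2l t2r j1l j1r j2l j2r ed d0; lra.
Qed.

End local_oscillation.

(** * From small oscillation to the precise representative *)

Section precise_representative.
Context {R : realType}.
Notation mu := (@lebesgue_measure R).
Notation mu2 := (@lebesgue2 R).
Notation P2 := (measurableTypeR R * measurableTypeR R)%type.

(** The sup-norm ball; it contains the disc of radius [r] and lies in the disc of radius [2 * r]. *)
Definition ball2 (z : R * R) (r : R) : set (R * R) :=
  open_rect (z.1 - r) (z.1 + r) (z.2 - r) (z.2 + r).

Lemma discE (x y : R * R) (r : R) : 0 < r ->
  disc x r y <-> (y.1 - x.1) ^+ 2 + (y.2 - x.2) ^+ 2 < r ^+ 2.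
Proof.
move=> r0; rewrite /disc/= /euclid.
have rE : r = Num.sqrt (r ^+ 2) by rewrite sqrtr_sqr gtr0_norm.
by rewrite [X in _ < X]rE ltr_sqrt ?exprn_gt0.
Qed.

Lemma measurable_disc (x : R * R) (r : R) : 0 < r -> @measurable _ P2 (disc x r).
Proof.
move=> r0.
pose q (y : R * R) : R := (y.1 - x.1) ^+ 2 + (y.2 - x.2) ^+ 2.
have cq : continuous q.
  move=> y; rewrite /q.
  apply: (@cvgD _ _ _ _ _ (fun y : R * R => (y.1 - x.1) ^+ 2) (fun y : R * R => (y.2 - x.2) ^+ 2)).
    apply: (@cvgM _ _ _ _ (fun y : R * R => y.1 - x.1) (fun y : R * R => y.1 - x.1));
    by apply: cvgB; [exact: cvg_fst|exact: cvg_cst].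
  apply: (@cvgM _ _ _ _ (fun y : R * R => y.2 - x.2) (fun y : R * R => y.2 - x.2));
  by apply: cvgB; [exact: cvg_snd|exact: cvg_cst].
rewrite (_ : disc x r = q @^-1` `]-oo, (r ^+ 2)[); last first.
  apply/seteqP; split => y /=; rewrite in_itv/=; first by move/(discE _ _ r0).
  by move=> h; exact/(discE _ _ r0).
by rewrite -[X in measurable X]setTI; apply: (continuous_measurable2 cq).
Qed.

Lemma disc_sub (x : R * R) (r : R) : 0 < r -> disc x r `<=` ball2 x r.
Proof.
move=> r0 y /(discE _ _ r0) h.
have h1 := sqr_ge0 (y.1 - x.1); have h2 := sqr_ge0 (y.2 - x.2).
have abs (s : R) : s ^+ 2 < r ^+ 2 -> - r < s < r.
  by move=> sr; rewrite -ltr_norml -[ltRHS]gtr0_norm// -ltr_sqr ?nnegrE// !real_normK ?num_real.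
have /andP[a1 a2] : - r < y.1 - x.1 < r by apply: abs; clear - h h1 h2; lra.
have /andP[b1 b2] : - r < y.2 - x.2 < r by apply: abs; clear - h h1 h2; lra.
by split; rewrite /= in_itv/=; apply/andP; split; clear - a1 a2 b1 b2; lra.
Qed.

Lemma sub_disc (x : R * R) (r : R) : 0 < r -> ball2 x (r / 2) `<=` disc x r.
Proof.
move=> r0 y [/= + +]; rewrite !in_itv/= => /andP[a1 a2] /andP[b1 b2].
apply/(discE _ _ r0).
have abs (s : R) : - (r / 2) < s -> s < r / 2 -> s ^+ 2 < r ^+ 2 / 4.
  by move=> s1 s2; clear - s1 s2 r0; nra.
have q1 : (y.1 - x.1) ^+ 2 < r ^+ 2 / 4 by apply: abs; clear - a1 a2; lra.
have q2 : (y.2 - x.2) ^+ 2 < r ^+ 2 / 4 by apply: abs; clear - b1 b2; lra.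
have := sqr_ge0 r; clear - q1 q2; lra.
Qed.

Lemma lebesgue2_open_rect (a b c d : R) : a < b -> c < d ->
  mu2 (open_rect a b c d) = ((b - a) * (d - c))%:E.
Proof.
move=> ab cd; rewrite lebesgue2X; [|exact: measurable_itv..].
by rewrite EFinM; congr (_ * _)%E; exact: lebesgue_measure_oo.
Qed.

Lemma average_near (f : R * R -> R) (x : R * R) (r s c e : R) :
  Defs.locally_integrable f -> 0 < s <= r ->
  {ae mu2, forall z, ball2 x r z -> `|f z - c| <= e} -> `|average f x s - c| <= e.
Proof.
move=> lf /andP[s0 sr] fc.
have s2 : 0 < s / 2 by rewrite divr_gt0.
have mD := measurable_disc x s0.
set D := disc x s in mD *.
have Dsub : D `<=` ball2 x r.
  move=> y /(disc_sub s0) [/= + +]; rewrite !in_itv/= => /andP[a1 a2] /andP[b1 b2].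
  by split; rewrite /= in_itv/=; apply/andP; split; clear - a1 a2 b1 b2 sr; lra.
have Dfin : (mu2 D < +oo)%E.
  apply: le_lt_trans (lebesgue2_rect_lty (x.1 - s) (x.1 + s) (x.2 - s) (x.2 + s)).
  rewrite le_measure ?inE//; first exact: measurable_rect.
  move=> y /(disc_sub s0) [/= + +]; rewrite !in_itv/= => /andP[a1 a2] /andP[b1 b2].
  by split; rewrite /= in_itv/= !ltW.
have Dgt : (0 < mu2 D)%E.
  apply: lt_le_trans (_ : 0 < mu2 (ball2 x (s / 2)))%E _.
    rewrite lebesgue2_open_rect; [|by clear - s2; lra..].
    by rewrite lte_fin mulr_gt0//; clear - s2; lra.
  by rewrite le_measure ?inE//; [exact: measurable_open_rect|exact: sub_disc].
have m0 : 0 < fine (mu2 D) by rewrite fine_gt0// Dgt.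
have fD : mu2.-integrable D (EFin \o f).
  have [_ fK] := lf.
  have Dbox : D `<=` rect (x.1 - s) (x.1 + s) (x.2 - s) (x.2 + s).
    move=> y /(disc_sub s0) [/= + +]; rewrite !in_itv/= => /andP[a1 a2] /andP[b1 b2].
    by split; rewrite /= in_itv/= !ltW.
  have mR := @measurable_rect R (x.1 - s) (x.1 + s) (x.2 - s) (x.2 + s).
  apply: (integrableS mR mD Dbox); apply: fK; exact: compact_rect.
have cD (k : R) : mu2.-integrable D (EFin \o cst k).
  by apply: measurable_bounded_integrable => //; exact: bounded_cst.
have EC (k : R) : \int[mu2]_(t in D) (cst k) t = k * fine (mu2 D) by rewrite Rintegral_cst.
have up : \int[mu2]_(y in D) f y <= (c + e) * fine (mu2 D).
  rewrite -EC; apply: ae_le_Rintegral => //.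
  move: fc; apply: (@aeS _ _ _ mu2) => y fy /Dsub/fy.
  by rewrite ler_norml => /andP[h1 h2]; clear - h2; rewrite /=; lra.
have lo : (c - e) * fine (mu2 D) <= \int[mu2]_(y in D) f y.
  rewrite -EC; apply: ae_le_Rintegral => //.
  move: fc; apply: (@aeS _ _ _ mu2) => y fy /Dsub/fy.
  by rewrite ler_norml => /andP[h1 h2]; clear - h1; rewrite /=; lra.
rewrite /average -/D; move: (Rintegral _ _ _) (fine _) m0 up lo => I m m0 up lo.
have -> : m^-1 * I - c = (I - c * m) / m by field; rewrite gt_eqF.
rewrite normrM [`|_^-1|]gtr0_norm ?invr_gt0// ler_pdivrMr// ler_norml.
by apply/andP; split; clear - up lo; lra.
Qed.

(** Small oscillation at every precision makes the averages Cauchy, so [precise] is a genuine limit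
    here and not the default 0. One average within e of both the limit and [c] gives 2e. *)
Lemma precise_near (f : R * R -> R) (x : R * R) (r c e : R) :
  Defs.locally_integrable f -> 0 < r -> 0 < e ->
  (forall e', 0 < e' -> exists r' c' : R, 0 < r' /\
     {ae mu2, forall z, ball2 x r' z -> `|f z - c'| <= e'}) ->
  {ae mu2, forall z, ball2 x r z -> `|f z - c| <= e} ->
  `|precise f x - c| <= 2 * e.
Proof.
move=> lf r0 e0 osc fc.
have near_avg (r' c' e' : R) : 0 < r' ->
    {ae mu2, forall z, ball2 x r' z -> `|f z - c'| <= e'} ->
    \forall s \near 0^'+, `|average f x s - c'| <= e'.
  move=> r'0 fc'; near=> s; apply: (average_near lf _ fc').
  by apply/andP; split; near: s; [exact: nbhs_right_gt|exact: nbhs_right_le].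
have cvg_avg : cvg (average f x s @[s --> 0^'+]).
  apply: cauchy_cvg; apply: cauchy_exP => e' /= e'0.
  have e'2 : 0 < e' / 2 by rewrite divr_gt0.
  have [r' [c' [r'0 fc']]] := osc _ e'2.
  exists c'; have := near_avg _ _ _ r'0 fc'; apply: filterS => s hs.
  rewrite /ball/= distrC; apply: le_lt_trans hs _.
  by clear - e'0; lra.
rewrite /precise ifT; last exact/asboolP.
set l := lim _.
have /cvgrPdist_le/(_ _ e0) hl : average f x s @[s --> 0^'+] --> l by exact: cvg_avg.
have [s [hs1 hs2]] : exists s, `|l - average f x s| <= e /\ `|average f x s - c| <= e.
  have : \forall s \near 0^'+, `|l - average f x s| <= e /\ `|average f x s - c| <= e.
    have hc := near_avg _ _ _ r0 fc.
    by near=> s; split; near: s.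
  by move=> hs; have [s ?] := @filter_ex _ _ (at_right_proper_filter (0 : R)) _ hs; exists s.
rewrite (_ : l - c = (l - average f x s) + (average f x s - c)); last by rewrite addrA subrK.
by apply: le_trans (ler_normD _ _) _; clear - hs1 hs2; lra.
Unshelve. all: by end_near. Qed.

(** The same [c] serves every [y] close to [x], because the ball of radius r/2 around [y] lies in
    the one of radius r around [x]. Each precise value is then within 2(e/4) of [c]. *)
Lemma precise_continuous (f : R * R -> R) : Defs.locally_integrable f ->
  (forall x e, 0 < e -> exists r c : R, 0 < r /\
     {ae mu2, forall z, ball2 x r z -> `|f z - c| <= e}) ->
  continuous (precise f).
Proof.
move=> lf osc x; apply/cvgrPdist_le => e e0.
have e4 : 0 < e / 4 by rewrite divr_gt0.
have [r [c [r0 fc]]] := osc x _ e4.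
have r2 : 0 < r / 2 by rewrite divr_gt0.
have px := precise_near lf r0 e4 (osc x) fc.
have nb : nbhs x (ball2 x (r / 2)).
  exists (ball x.1 (r / 2), ball x.2 (r / 2)); first by split; exact: nbhsx_ballx.
  move=> [s t] [/= + +]; rewrite /ball/= !ltr_norml => /andP[c1 c2] /andP[d1 d2].
  by split; rewrite /= in_itv/=; apply/andP; split; clear - c1 c2 d1 d2; lra.
near=> y.
have xy : ball2 x (r / 2) y by near: y; exact: nb.
have py : `|precise f y - c| <= 2 * (e / 4).
  apply: (precise_near lf r2 e4 (osc y)).
  move: fc; apply: (@aeS _ _ _ mu2) => z fz [/= + +].
  rewrite !in_itv/= => /andP[a1 a2] /andP[b1 b2]; apply: fz.
  move: xy => [/= + +]; rewrite !in_itv/= => /andP[c1 c2] /andP[d1 d2].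
  by split; rewrite /= in_itv/=; apply/andP; split; clear - a1 a2 b1 b2 c1 c2 d1 d2; lra.
rewrite (_ : precise f x - precise f y = (precise f x - c) - (precise f y - c)).
  apply: le_trans (ler_normB _ _) _; apply: le_trans (lerD px py) _.
  by clear - e0; lra.
by rewrite opprB addrA subrK.
Unshelve. all: by end_near. Qed.

Lemma monotone_precise_continuous (g : R * R -> R) :
  sobolev 2%:E g -> ess_bounded g -> monotone_fun g -> continuous (precise g).
Proof.
move=> [_ [u [[lg l0 l1 g0 g1] u0 u1]]] [M gM] [_ gmon].
apply: precise_continuous => // x e e0.
exact: (local_oscillation x lg l0 l1 g0 g1
  (Lfun2_integrable_sqr u0) (Lfun2_integrable_sqr u1) gM gmon e0).
Qed.

End precise_representative.

Theorem theorem1p8 (R : realType) :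
  (forall g : R * R -> R,
      sobolev 1%E g -> sobolev 2%:E g -> ess_bounded g -> monotone_fun g ->
      continuous (precise g)) /\
  (forall (f : R * R -> R) (D : set nat) (f_ : nat -> R * R -> R),
      sobolev 2%:E f -> compactly_supported f ->
      monotone_decomposition f D f_ ->
      forall i, D i -> continuous (precise (f_ i))).
Proof.
split=> [g _ g2 gb gmon|f D f_ _ _ [Hf _ _ _] i /Hf[f2 _ fmon fb]].
  exact: monotone_precise_continuous.
(* Either sign condition on a component bounds its absolute value by 1. *)
apply: monotone_precise_continuous => //; exists 1.
case: fb; apply: aeS => z /andP[h1 h2]; rewrite ler_norml; apply/andP; split => //.
- exact: le_trans h1.
- exact: le_trans h2 _.
Qed.
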